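(* Let $N\ge1$, let $\Xi$ be a standard normally distributed random $N$-vector, and let $\{\Xi_{n,k}\}_{n\ge1,\,1\le k\le n}$ be an $N$-STA with row sums $\Sigma_n=\sum_{k=1}^n\Xi_{n,k}$. Suppose that $\{\Xi_{n,k}\}$ is infinitesimal. Then $\lambda(\Sigma_n\to\Xi)\le 2\,\mathrm{Lin}(\{\Xi_{n,k}\})$; more explicitly, $$\sup_{t\in\mathbb{R}^N}\limsup_{n\to\infty}\left|\phi_\Xi(t)-\phi_{\Sigma_n}(t)\right|\le 2\,\mathrm{Lin}(\{\Xi_{n,k}\}).$$
   Context: $|\cdot|$ and $\langle\cdot,\cdot\rangle$ are the Euclidean norm and inner product on $\mathbb{R}^N$. A random $N$-vector is an $\mathbb{R}^N$-valued random variable. An $N$-dimensional standard triangular array ($N$-STA) is a triangular array $\{\Xi_{n,k}\}_{n\ge1,\,1\le k\le n}$ of random $N$-vectors such that: (1) for every $n$, $\Xi_{n,1},\dots,\Xi_{n,n}$ are independent; (2) $\mathbb{E}[\Xi_{n,k}]=0$ for all $n,k$; (3) for every $n$, $\mathrm{cov}(\Sigma_n)=I_{N\times N}$ where $\Sigma_n=\sum_{k=1}^n\Xi_{n,k}$. $\phi_H(t)=\mathbb{E}[\exp(-i\langle t,H\rangle)]$ for a random $N$-vector $H$ and $t\in\mathbb{R}^N$. Limit operator: $\lambda(\Sigma_n\to\Xi)=\sup_{t\in\mathbb{R}^N}\limsup_{n\to\infty}|\phi_\Xi(t)-\phi_{\Sigma_n}(t)|$. $\{\Xi_{n,k}\}$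 is infinitesimal if for every $\epsilon>0$, $\max_{1\le k\le n}\mathbb{P}[|\Xi_{n,k}|>\epsilon]\to0$ as $n\to\infty$. Lindeberg index: $\mathrm{Lin}(\{\Xi_{n,k}\})=\sup_{\epsilon>0}\limsup_{n\to\infty}\sum_{k=1}^n\mathbb{E}\big[|\Xi_{n,k}|^2;\,|\Xi_{n,k}|>\epsilon\big]$, where $\mathbb{E}[X;A]=\mathbb{E}[X\mathbf 1_A]$. *)

(* Defs.v *)
From HB Require Import structures.
From mathcomp Require Import all_boot all_order all_algebra.
From mathcomp Require Import all_classical all_reals all_analysis.
From mathcomp Require Import complex.
Set Implicit Arguments. Unset Strict Implicit. Unset Printing Implicit Defensive.
Import Order.TTheory GRing.Theory Num.Theory.
Import numFieldNormedType.Exports.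
Local Open Scope classical_set_scope.
Local Open Scope ring_scope.

Section euclidean.
Context {R : realType} {N : nat}.
Implicit Types x y : 'rV[R]_N.

Definition dotp x y : R := \sum_(i < N) x 0 i * y 0 i.

(* The library norm `|x| on 'rV[R]_N is the max-norm, hence this definition. *)
Definition enorm x : R := Num.sqrt (dotp x x).

End euclidean.

(* R^N with its Borel sigma-algebra, generated by the open sets. *)
Definition borelRV (R : realType) (N : nat) : Type :=
  g_sigma_algebraType (@open 'rV[R]_N).

HB.instance Definition _ (R : realType) (N : nat) :=
  Measurable.on (borelRV R N).

Definition vcoord (T : Type) (R : realType) (N : nat) (i : 'I_N)
  (H : T -> 'rV[R]_N) : T -> R := fun w => H w 0 i.

Section random_vectors.
Context d (T : measurableType d) (R : realType) (P : probability T R).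

Definition mutually_independent d' (T' : measurableType d') (I : finType)
    (X : I -> T -> T') : Prop :=
  forall (J : {set I}) (B : I -> set T'), (forall i, measurable (B i)) ->
    P (\bigcap_(i in [set` J]) (X i @^-1` B i)) =
    (\prod_(i in J) P (X i @^-1` B i))%E.

Definition std_normal N (H : T -> 'rV[R]_N) : Prop :=
  mutually_independent (fun i : 'I_N => vcoord i H : T -> measurableTypeR R) /\
  forall (i : 'I_N) (B : set (measurableTypeR R)), measurable B ->
    P (vcoord i H @^-1` B) = normal_prob 0 1 B.

Definition expi (x : R) : R[i] := (cos x +i* sin x)%C.

Definition Cexpectation (Z : T -> R[i]) : R[i] :=
  (fine 'E_P[fun w => complex.Re (Z w)]%E +i*
   fine 'E_P[fun w => complex.Im (Z w)]%E)%C.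

(* E[exp(- i <t, H>)] *)
Definition charfun N (H : T -> 'rV[R]_N) (t : 'rV[R]_N) : R[i] :=
  Cexpectation (fun w => expi (- dotp t (H w))).

End random_vectors.

Section triangular_arrays.
Context (R : realType) (N : nat).

(* Each row n may live on its own probability space (T n, P n); 'I_n indexes
   the n entries of row n from 0. *)
Context (d : nat -> measure_display) (T : forall n, measurableType (d n)).
Variable P : forall n, probability (T n) R.
Variable Xi : forall n, 'I_n -> {RV (P n) >-> borelRV R N}.

Definition row_sum n (w : T n) : 'rV[R]_N := \sum_(k < n) (Xi k w : 'rV[R]_N).

(* Rows are numbered from 1. As expectations are \bar R-valued, the equations
   on the mean and on the covariance force the integrability of the entries
   and the square integrability of the row sums. *)
Record STA : Prop := {
  STA_indep : forall n, (0 < n)%N ->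
    mutually_independent (P n) (fun k : 'I_n => Xi k : T n -> borelRV R N);
  STA_mean : forall n (k : 'I_n) (i : 'I_N),
    ('E_(P n)[vcoord i (Xi k : T n -> 'rV[R]_N)] = 0)%E;
  STA_cov : forall n, (0 < n)%N -> forall i j : 'I_N,
    covariance (P n) (vcoord i (@row_sum n)) (vcoord j (@row_sum n)) =
    ((1%:M : 'M[R]_N) i j)%:E }.

Definition infinitesimal : Prop := forall eps : R, 0 < eps ->
  (fun n => \big[maxe/0%E]_(k < n) P n [set w | eps < enorm (Xi k w)])
    @ \oo --> 0%E.

Definition Lin : \bar R :=
  ereal_sup [set limn_esup (fun n => (\sum_(k < n)
      'E_(P n)[(fun w => enorm (Xi k w) ^+ 2 *
                         \1_[set w' | eps < enorm (Xi k w')] w)%R])%E)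
    | eps in [set eps : R | 0 < eps]].

End triangular_arrays.

(* lambda(S_n -> H) *)
Definition limit_op (R : realType) (N : nat)
    (d : nat -> measure_display) (T : forall n, measurableType (d n))
    (P : forall n, probability (T n) R) (S : forall n, T n -> 'rV[R]_N)
    (d0 : measure_display) (T0 : measurableType d0) (P0 : probability T0 R)
    (H : T0 -> 'rV[R]_N) : \bar R :=
  ereal_sup [set limn_esup (fun n =>
      (Normc.normc (charfun P0 H t - charfun (P n) (@S n) t))%:E)
    | t in [set: 'rV[R]_N]].

(* Main.v *)
Require Import Defs.
From mathcomp Require Import all_boot all_order all_algebra.
From mathcomp Require Import all_classical all_reals all_analysis.
From mathcomp Require Import complex.
From mathcomp Require Import measurable_realfun ring lra.
Set Implicit Arguments. Unset Strict Implicit. Unset Printing Implicit Defensive.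
Import Order.TTheory GRing.Theory Num.Theory.
Import numFieldNormedType.Exports.
Local Open Scope classical_set_scope.
Local Open Scope ring_scope.

(* Fix t, put Y_k = <t, Xi_{n,k}> and tau = |t|^2, and let f(s) be the
   expectation of exp(-i s sum_k Y_k). Independence gives
     i f'(s) = sum_k E[Y_k exp(-i s Y_k)] prod_{j <> k} phi_j(s),
   and since E[Y_k] = 0 and sum_k E[Y_k^2] = tau, f satisfies the Gaussian
   equation f' + s tau f = 0 up to an error of norm at most s tau C, where
     C = 2 L_n(eps) + O(|t| eps) + 2 max_k P[|Xi_{n,k}| > eps]
   and L_n(eps) is the n-th Lindeberg sum. The factor 2 comes from
   |exp(-iy) - 1 + iy| <= 2 |y|, used on the event |Xi_{n,k}| > eps. Multiplying
   by the integrating factor exp(s^2 tau / 2) and integrating over [0, 1] costs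
   no factor depending on t: |f(1) - exp(-tau / 2)| <= C (1 - exp(-tau / 2)).
   The normal characteristic function is the case C = 0, by Stein's identity.
   If Lin is finite, the entries are square integrable for large n; otherwise
   there is nothing to prove. *)

(** The error in the Gaussian equation has to be proportional to s tau, because s tau exp(s^2 tau /
    2) is the derivative of the integrating factor. This is achieved because the identity covariance
    makes tau = |t|^2 play two roles: it is the variance of <t, Sigma_n>, and it is the
    Cauchy-Schwarz factor between <t, Xi>^2 and |Xi|^2. The tails therefore contribute tau L_n(eps),
    with no other trace of t. The term |t| eps does depend on t, but t is fixed before eps tends to
    0. The probabilities enter because i f'(s) carries products that omit the k-th factor, while s
    tau f carries the full product. Exchanging one for the other costs s E[Y_k^2] |phi_k(s) - 1|,
    and infinitesimality makes all phi_k close to 1 at once. Independence is given for events only,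
    so it must first be carried over to expectations of complex products. *)

Section transfer.
Import HBNNSimple.
Context d d2 (T : measurableType d) (T2 : measurableType d2).
Context d' (T' : measurableType d') (R : realType).
Variables (mu : {measure set T -> \bar R}) (nu : {measure set T2 -> \bar R}).
Variables (X : T -> T') (Y : T2 -> T') (Z : T -> R) (C : R).
Hypothesis mX : measurable_fun setT X.
Hypothesis mY : measurable_fun setT Y.
Hypothesis mZ : measurable_fun setT Z.
Hypothesis Z0 : forall w, 0 <= Z w.
Hypothesis ZX : forall B, measurable B ->
  (\int[mu]_w (Z w * \1_B (X w))%:E = C%:E * nu (Y @^-1` B))%E.
Local Open Scope ereal_scope.

(** The hypothesis [ZX] says that the image under [X] of the measure with density [Z] is [C] times
    the image of [nu] under [Y]. Simple functions and monotone convergence pass from sets to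
    functions. It serves twice: with [Z] the product of the other factors of an independent product,
    and with [Z] the normal density. *)
Lemma ge0_integral_transfer (f : T' -> \bar R) :
  measurable_fun [set: T'] f -> (forall x, 0 <= f x) ->
  \int[mu]_w ((Z w)%:E * f (X w)) = C%:E * \int[nu]_x f (Y x).
Proof.
move=> mf f0; pose h := nnsfun_approx measurableT mf.
have hX n : measurable_fun setT (fun w => h n (X w)) by exact: measurableT_comp.
have hY n : measurable_fun setT (fun w => h n (Y w)) by exact: measurableT_comp.
have step n : \int[mu]_w ((Z w)%:E * (h n (X w))%:E) =
              C%:E * \int[nu]_x (h n (Y x))%:E.
  (* A negative r is not a value of [h n], so its indicator vanishes. *)
  have i0 r x : 0 <= (r * \1_(h n @^-1` [set r]) x)%:E.
    by rewrite lee_fin; exact: nnfun_muleindic_ge0.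
  under eq_integral => w _ do rewrite (fimfunE (h n)) -fsumEFin// ge0_mule_fsumr//.
  under [in RHS]eq_integral => w _ do rewrite (fimfunE (h n)) -fsumEFin//.
  have mi r : measurable_fun setT (fun x : T' => (r * \1_(h n @^-1` [set r]) x)%:E).
    by apply/measurable_EFinP; apply: measurable_funM.
  rewrite ge0_integral_fsum//; last 2 first.
  - move=> r; apply: emeasurable_funM; first exact/measurable_EFinP.
    exact: (measurableT_comp (mi r)).
  - by move=> r w _; rewrite mule_ge0// lee_fin.
  rewrite ge0_integral_fsum//; last by move=> r; exact: (measurableT_comp (mi r)).
  rewrite ge0_mule_fsumr; last first.
    by move=> r; apply: integral_ge0 => x _; exact: i0.
  apply: eq_fsbigr => r /[!inE] -[y _ <-].
  set B := _ @^-1` _.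
  have mB : measurable B by exact: measurable_funPTI.
  have r0 : (0 <= h n y)%R by [].
  under eq_integral => w _ do rewrite -EFinM mulrCA EFinM.
  under [in RHS]eq_integral => w _ do rewrite EFinM.
  have m1 : measurable_fun setT (fun x => (\1_B (Y x))%:E : \bar R).
    by apply/measurable_EFinP; exact: measurableT_comp.
  rewrite ge0_integralZl//.
  rewrite ge0_integralZl//; last 2 first.
  - apply/measurable_EFinP; apply: measurable_funM => //.
    exact: measurableT_comp.
  - by move=> w _; rewrite lee_fin mulr_ge0.
  rewrite ZX// muleCA; congr (_ * (_ * _)).
  rewrite -[RHS]/(\int[nu]_x (\1_(Y @^-1` B) x)%:E) integral_indic ?setIT//.
  by rewrite -[_ @^-1` _]setTI; exact: mY.
transitivity (limn (fun n => \int[mu]_w ((Z w)%:E * (h n (X w))%:E))).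
  rewrite -monotone_convergence//.
  - apply: eq_integral => w _; apply/esym/cvg_lim => //.
    by apply: cvgeZl => //; exact: cvg_nnsfun_approx.
  - by move=> n; apply: emeasurable_funM; exact/measurable_EFinP.
  - by move=> n w _; rewrite mule_ge0// lee_fin.
  - by move=> w _ a b ab; rewrite lee_wpmul2l ?lee_fin//; exact/lefP/nd_nnsfun_approx.
under eq_fun do rewrite step.
have ndh x : nondecreasing_seq (fun n => (h n x)%:E).
  by move=> a b ab; rewrite lee_fin; exact/lefP/nd_nnsfun_approx.
rewrite limeMl//; last first.
  apply: ereal_nondecreasing_is_cvgn => a b ab; apply: ge0_le_integral => //.
  - by move=> x _; rewrite lee_fin.
  - exact/measurable_EFinP.
  - exact/measurable_EFinP.
  - by move=> x _; exact: ndh.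
congr (_ * _); rewrite -monotone_convergence//.
- apply: eq_integral => w _; apply/cvg_lim => //.
  exact: cvg_nnsfun_approx.
- by move=> n; exact/measurable_EFinP.
- by move=> n x _; rewrite lee_fin.
Qed.
End transfer.

(** * Expectations of products of independent variables: nonnegative case *)

Section independent_products.
Context d d' (T : measurableType d) (T' : measurableType d') (R : realType).
Context (P : probability T R) (I : finType) (X : I -> T -> T').
Hypothesis mX : forall i, measurable_fun setT (X i).
Hypothesis indX : mutually_independent P X.

Lemma prod_indic (B : I -> set T') w :
  \prod_i \1_(B i) (X i w) =
  \1_(\bigcap_(i in [set` [set: I]%SET]) (X i @^-1` B i)) w :> R.
Proof.
rewrite indicE; have [Bw|] := boolP (w \in _).
  apply: big1 => i _; rewrite indicE mem_set//.
  by move/set_mem : Bw; apply; rewrite /= finset.in_setT.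
rewrite notin_setE => nB; apply/eqP/prodf_eq0.
apply: contra_notP nB => nB i _ /=; apply: contrapT => Bi; apply: nB.
by exists i => //; rewrite indicE memNset.
Qed.

Lemma measurable_prod_comp (g : I -> T' -> R) (Q : pred I) :
  (forall i, measurable_fun setT (g i)) ->
  measurable_fun setT (fun w => \prod_(i | Q i) g i (X i w)).
Proof.
move=> mg; under eq_fun do rewrite -big_filter.
by apply: measurable_prod => i _; exact: measurableT_comp.
Qed.

Lemma independent_ge0_prod (g : I -> T' -> R) :
  (forall i, measurable_fun setT (g i)) -> (forall i x, 0 <= g i x) ->
  (forall i, P.-integrable setT (fun w => (g i (X i w))%:E)) ->
  (\int[P]_w (\prod_i g i (X i w))%:E =
   (\prod_i \int[P]_w g i (X i w))%:E)%E.
Proof.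
(* Induction on a list of indices outside of which the g_i are indicators: the
   case of indicators is the hypothesis, and indicators are replaced by arbitrary
   functions one index at a time with ge0_integral_transfer. *)
suff H (s : seq I) : forall g : I -> T' -> R,
    (forall i, measurable_fun setT (g i)) -> (forall i x, 0 <= g i x) ->
    (forall i, P.-integrable setT (fun w => (g i (X i w))%:E)) ->
    (forall i, i \notin s -> exists2 B, measurable B & g i = \1_B) ->
    (\int[P]_w (\prod_i g i (X i w))%:E =
     (\prod_i \int[P]_w g i (X i w))%:E)%E.
  move=> mg g0 ig; apply: (H (enum I)) => // i.
  by rewrite mem_enum.
elim: s => [{}g mg g0 ig gB|k s IH {}g mg g0 ig gB].
  have /choice[B BP] : forall i, exists B, measurable B /\ g i = \1_B.
    by move=> i; have [//|B mB gBi] := gB i; exists B.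
  under eq_integral => w _.
    under eq_bigr do rewrite (BP _).2.
    rewrite prod_indic; over.
  have mXB i : measurable (X i @^-1` B i).
    by rewrite -[_ @^-1` _]setTI; apply: mX => //; exact: (BP i).1.
  rewrite integral_indic//; last first.
    apply: fin_bigcap_measurable => //.
  rewrite setIT; transitivity (\prod_(i in [set: I]%SET) P (X i @^-1` B i))%E.
    by apply: indX => i; exact: (BP i).1.
  rewrite -prodEFin; apply: eq_big => i; first by rewrite finset.in_setT.
  move=> _; rewrite (BP i).2 /Rintegral fineK; last first.
    by apply: integrable_fin_num => //; rewrite -(BP i).2.
  have -> : (fun w => (\1_(B i) (X i w))%:E) = EFin \o \1_(X i @^-1` B i).
    by [].
  by rewrite integral_indic// setIT.
pose Z w := \prod_(i | i != k) g i (X i w).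
pose C := \prod_(i | i != k) \int[P]_w g i (X i w).
have gk0 w : 0 <= Z w by apply: prodr_ge0.
(* The induction hypothesis, applied with the k-th factor replaced by an indicator, is exactly the
   hypothesis of the transfer lemma, for the density [Z] and the constant [C]. *)
have ZB B : measurable B ->
  (\int[P]_w (Z w * \1_B (X k w))%:E = C%:E * P (X k @^-1` B))%E.
  move=> mB; pose g' i := if i == k then \1_B else g i.
  have mXB : measurable (X k @^-1` B) by rewrite -[_ @^-1` _]setTI; exact: mX.
  have iB : P.-integrable setT (EFin \o \1_(X k @^-1` B)).
    exact: integrable_indic.
  have := IH g'; rewrite (bigD1 k)//= /g' eqxx.
  under [in X in _ -> _ -> _ -> _ -> X = _]eq_integral => w _.
    rewrite (bigD1 k)//= /g' eqxx mulrC.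
    under eq_bigr => i /negPf ik do rewrite ik.
    over.
  under eq_bigr => i /negPf ik do rewrite ik.
  rewrite -/C => ->.
  - rewrite EFinM muleC; congr (_ * _)%E.
    rewrite /Rintegral fineK; last exact: integrable_fin_num iB.
    by rewrite -[LHS]/(\int[P]_w (\1_(X k @^-1` B) w)%:E)%E integral_indic// setIT.
  - by move=> i; case: ifP.
  - by move=> i x; case: ifP.
  - by move=> i; case: ifP => [/eqP->|].
  - move=> i si; case: ifPn => [_|ik]; first by exists B.
    by apply: gB; rewrite inE negb_or ik.
under eq_integral => w _ do rewrite (bigD1 k)//= mulrC EFinM.
have := @ge0_integral_transfer _ _ _ _ _ _ _ P P (X k) (X k) Z C (mX k) (mX k)
  (measurable_prod_comp _ mg) gk0 ZB (EFin \o g k).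
rewrite /Z /= => ->.
- rewrite [in RHS](bigD1 k)//= mulrC EFinM -/C; congr (_ * _)%E.
  by rewrite /Rintegral fineK//; exact: integrable_fin_num (ig k).
- exact/measurable_EFinP.
- by move=> x; rewrite lee_fin.
Qed.

End independent_products.

(** * Complex modulus and complex expectation *)

Section normc.
Context {R : rcfType}.
Implicit Types z : R[i].

Lemma normc_ge0 z : 0 <= Normc.normc z.
Proof. by case: z => a b; exact: sqrtr_ge0. Qed.

Lemma normc_conj z : Normc.normc z^*%C = Normc.normc z.
Proof. by case: z => a b /=; rewrite sqrrN. Qed.

Lemma Re_conj_mul z : Normc.normc z ^+ 2 = complex.Re (z^*%C * z).
Proof. by case: z => a b /=; rewrite sqr_sqrtr ?addr_ge0 ?sqr_ge0//; ring. Qed.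

Lemma ler_Re_normc z : complex.Re z <= Normc.normc z.
Proof.
case: z => a b /=; rewrite (le_trans (ler_norm _))// -sqrtr_sqr.
by rewrite ler_wsqrtr// lerDl sqr_ge0.
Qed.

End normc.

Section complex_expectation.
Context d (T : measurableType d) (R : realType) (P : probability T R).
Implicit Types Z : T -> R[i].

Definition Cintegrable Z :=
  P.-integrable setT (fun w => (complex.Re (Z w))%:E) /\
  P.-integrable setT (fun w => (complex.Im (Z w))%:E).

Lemma CexpectationE Z : Cexpectation P Z =
  (\int[P]_w complex.Re (Z w) +i* \int[P]_w complex.Im (Z w))%C.
Proof. by rewrite /Cexpectation unlock. Qed.

Lemma CintegrableD Z1 Z2 : Cintegrable Z1 -> Cintegrable Z2 ->
  Cintegrable (fun w => Z1 w + Z2 w).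
Proof.
move=> [r1 i1] [r2 i2]; split.
  have := integrableD measurableT r1 r2; congr (P.-integrable _ _).
  by apply/funext => w; rewrite -EFinD; case: (Z1 w) (Z2 w) => [? ?] [].
have := integrableD measurableT i1 i2; congr (P.-integrable _ _).
by apply/funext => w; rewrite -EFinD; case: (Z1 w) (Z2 w) => [? ?] [].
Qed.

Lemma CexpectationD Z1 Z2 : Cintegrable Z1 -> Cintegrable Z2 ->
  Cexpectation P (fun w => Z1 w + Z2 w) =
  Cexpectation P Z1 + Cexpectation P Z2.
Proof.
move=> [r1 i1] [r2 i2]; rewrite !CexpectationE; apply/eqP.
rewrite eq_complex /= -!RintegralD//; apply/andP; split; apply/eqP;
  apply: eq_Rintegral => w _; by case: (Z1 w) (Z2 w) => [? ?] [].
Qed.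

Lemma CintegrableZ (c : R[i]) Z : Cintegrable Z -> Cintegrable (fun w => c * Z w).
Proof.
case: c => a b [r i]; split.
  have := integrableB measurableT (integrableZl measurableT a r)
    (integrableZl measurableT b i); congr (P.-integrable _ _).
  by apply/funext => w; rewrite -!EFinM -EFinB; case: (Z w).
have := integrableD measurableT (integrableZl measurableT a i)
  (integrableZl measurableT b r); congr (P.-integrable _ _).
by apply/funext => w; rewrite -!EFinM -EFinD; case: (Z w) => * /=; rewrite addrC.
Qed.

Lemma CexpectationZ (c : R[i]) Z : Cintegrable Z ->
  Cexpectation P (fun w => c * Z w) = c * Cexpectation P Z.
Proof.
case: c => a b [r i]; rewrite !CexpectationE; apply/eqP.
have ar := integrableZl measurableT a r.
have ai := integrableZl measurableT a i.
have br := integrableZl measurableT b r.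
have bi := integrableZl measurableT b i.
rewrite eq_complex /= -!RintegralZl// -RintegralB// -RintegralD//.
apply/andP; split; apply/eqP; apply: eq_Rintegral => w _; case: (Z w) => //= x y.
Qed.

Lemma Cintegrable_real (f : T -> R) : P.-integrable setT (fun w => (f w)%:E) ->
  Cintegrable (fun w => (f w)%:C%C).
Proof. by move=> fi; split => //=; exact: integrable0. Qed.

Lemma Cexpectation_real (f : T -> R) :
  Cexpectation P (fun w => (f w)%:C%C) = (\int[P]_w f w)%:C%C.
Proof. by rewrite CexpectationE /= /Rintegral integral0. Qed.

Lemma Cintegrable_sum (I : Type) (s : seq I) (Z : I -> T -> R[i]) :
  (forall i, Cintegrable (Z i)) -> Cintegrable (fun w => \sum_(i <- s) Z i w).
Proof.
move=> iZ; elim: s => [|i s IH].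
  under eq_fun do rewrite big_nil.
  by split; exact: integrable0.
by under eq_fun do rewrite big_cons; exact: CintegrableD.
Qed.

Lemma Cexpectation_sum (I : Type) (s : seq I) (Z : I -> T -> R[i]) :
  (forall i, Cintegrable (Z i)) -> Cexpectation P (fun w => \sum_(i <- s) Z i w) =
  \sum_(i <- s) Cexpectation P (Z i).
Proof.
move=> iZ; elim: s => [|i s IH].
  under eq_fun do rewrite big_nil.
  by rewrite big_nil CexpectationE /= /Rintegral !integral0.
under eq_fun do rewrite big_cons.
by rewrite CexpectationD// ?IH ?big_cons//; exact: Cintegrable_sum.
Qed.

(** Rotation argument: with z = E[Z], |z|^2 is the real part of E[conj(z) Z], hence at most |z|
    E[g]; then divide by |z|. *)
Lemma le_normc_Cexpectation Z (g : T -> R) : Cintegrable Z ->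
  P.-integrable setT (fun w => (g w)%:E) ->
  (forall w, Normc.normc (Z w) <= g w) ->
  Normc.normc (Cexpectation P Z) <= \int[P]_w g w.
Proof.
move=> iZ ig Zg; set z := Cexpectation P Z.
have [z0|z0] := eqVneq (Normc.normc z) 0.
  rewrite z0; apply: Rintegral_ge0 => w _; exact: le_trans (normc_ge0 _) (Zg w).
have zp : 0 < Normc.normc z by rewrite lt_neqAle eq_sym z0 normc_ge0.
rewrite -(ler_pM2l zp) -expr2 Re_conj_mul -CexpectationZ// CexpectationE /=.
rewrite -RintegralZl//; apply: le_Rintegral => //.
- exact: (CintegrableZ _ iZ).1.
- by rewrite /comp; under eq_fun do rewrite EFinM; exact: integrableZl.
move=> w _; apply: (le_trans (ler_Re_normc _)).
rewrite Normc.normcM -[X in _ <= X * _](normc_conj z).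
by rewrite ler_pM ?normc_ge0.
Qed.

End complex_expectation.

(** * Expectations of products of independent variables: complex case *)

Section complex_independent_products.
Context d d' (T : measurableType d) (T' : measurableType d') (R : realType).
Context (P : probability T R) (I : finType) (X : I -> T -> T').
Hypothesis mX : forall i, measurable_fun setT (X i).
Hypothesis indX : mutually_independent P X.
Variable g : I -> T' -> R[i].
Hypothesis mRe : forall i, measurable_fun setT (fun x => complex.Re (g i x)).
Hypothesis mIm : forall i, measurable_fun setT (fun x => complex.Im (g i x)).
Hypothesis ig : forall i, Cintegrable P (fun w => g i (X i w)).

(* z is the combination with coefficients 1, -1, i, -i of the positive and
   negative parts of its real and imaginary parts, so that a product of complex
   functions expands into products of nonnegative ones. *)
Let part (j : bool * bool) (z : R[i]) : R :=
  Num.max ((-1) ^+ j.2 * (if j.1 then complex.Im z else complex.Re z)) 0.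
Let unit4 (j : bool * bool) : R[i] := (-1) ^+ j.2 * (if j.1 then 'i%C else 1).

Let partE z : z = \sum_j unit4 j * (part j z)%:C%C.
Proof.
rewrite -(pair_bigA _ (fun a b => unit4 (a, b) * (part (a, b) z)%:C%C)) /=.
rewrite !big_bool /part /unit4 /= !expr1 !expr0 !mul1r !mulN1r.
have H (a : R) : Num.max a 0 - Num.max (- a) 0 = a.
  by rewrite /Num.max; case: ifPn; case: ifPn; lra.
case: z => a b /=; simpc; rewrite -[in LHS](H a) -[in LHS](H b).
by congr (_ +i* _)%C; ring.
Qed.

Let part_ge0 j z : 0 <= part j z.
Proof. by rewrite /part le_max lexx orbT. Qed.

Let mpart j i : measurable_fun setT (fun x => part j (g i x)).
Proof.
apply: measurable_maxr => //; apply: measurable_funM => //.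
by case: j.1.
Qed.

Let ipart j i : P.-integrable setT (fun w => (part j (g i (X i w)))%:E).
Proof.
have aux (u : T -> R) k : P.-integrable setT (fun w => (u w)%:E) ->
    measurable_fun setT u ->
    P.-integrable setT (fun w => (Num.max ((-1) ^+ k * u w) 0)%:E).
  move=> iu mu; apply: le_integrable iu => //.
    by apply/measurable_EFinP/measurable_maxr => //; exact: measurable_funM.
  move=> w _; rewrite lee_fin ger0_norm ?le_max ?lexx ?orbT// ge_max normr_ge0.
  by rewrite (le_trans (ler_norm _))// normrM normrX normrN1 expr1n mul1r.
case: j => [[] k]; rewrite /part /=; apply: aux.
- exact: (ig i).2.
- exact: (measurableT_comp (mIm i)).
- exact: (ig i).1.
- exact: (measurableT_comp (mRe i)).
Qed.

(** Distributivity turns the product over i of four-term sums into a sum over all choices f of one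
    part per index. Each term is a constant times a nonnegative product, whose expectation factors;
    distributivity read backwards reassembles the product of the expectations. *)
Lemma Cintegrable_prod : Cintegrable P (fun w => \prod_i g i (X i w)) /\
  Cexpectation P (fun w => \prod_i g i (X i w)) =
  \prod_i Cexpectation P (fun w => g i (X i w)).
Proof.
pose c (f : {ffun I -> bool * bool}) : R[i] := \prod_i unit4 (f i).
pose p (f : {ffun I -> bool * bool}) w := \prod_i part (f i) (g i (X i w)).
have E : (fun w => \prod_i g i (X i w)) = (fun w => \sum_f c f * (p f w)%:C%C).
  apply/funext => w; under eq_bigr => i _ do rewrite [g i _]partE.
  rewrite bigA_distr_bigA; apply: eq_bigr => f _.
  by rewrite big_split /= /p rmorph_prod.
have ip f : P.-integrable setT (fun w => (p f w)%:E).
  apply/integrableP; split.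
    exact/measurable_EFinP/(measurable_prod_comp mX _ (fun i => mpart (f i) i)).
  under eq_integral => w _ do rewrite gee0_abs ?lee_fin ?prodr_ge0//.
  (* The factorized integral is a real number, hence finite: integrability of the product comes from
     the product formula itself. *)
  by rewrite (independent_ge0_prod mX indX (g := fun i x => part (f i) (g i x)))// ltry.
have icp f : Cintegrable P (fun w => c f * (p f w)%:C%C).
  by apply: CintegrableZ; exact: Cintegrable_real.
rewrite E; split; first exact: Cintegrable_sum.
rewrite Cexpectation_sum//.
have Ei i : Cexpectation P (fun w => g i (X i w)) =
    \sum_j unit4 j * (\int[P]_w part j (g i (X i w)))%:C%C.
  under [X in Cexpectation P X]eq_fun do rewrite [g i _]partE.
  rewrite Cexpectation_sum; last first.
    by move=> j; apply: CintegrableZ; exact: Cintegrable_real.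
  apply: eq_bigr => j _; rewrite CexpectationZ ?Cexpectation_real//.
  exact: Cintegrable_real.
under [RHS]eq_bigr => i _ do rewrite Ei.
rewrite bigA_distr_bigA; apply: eq_bigr => f _.
rewrite CexpectationZ; last exact: Cintegrable_real.
rewrite Cexpectation_real big_split /= -rmorph_prod; congr (_ * _%:C%C).
rewrite {1}/Rintegral.
by rewrite (independent_ge0_prod mX indX (g := fun i x => part (f i) (g i x))).
Qed.

End complex_independent_products.

(** * Taylor estimates for exp(ix) *)

Section expi.
Context {R : realType}.
Implicit Types x y : R.

Lemma normc_le_add x y : Normc.normc (x +i* y)%C <= `|x| + `|y|.
Proof.
rewrite /= -[leRHS]ger0_norm ?addr_ge0// -sqrtr_sqr ler_wsqrtr//.
by rewrite sqrrD !real_normK ?num_real// addrAC lerDl mulrn_wge0// mulr_ge0.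
Qed.

Lemma expi0 : expi (0 : R) = 1.
Proof. by rewrite /expi cos0 sin0. Qed.

Lemma expiD x y : expi (x + y) = expi x * expi y.
Proof.
by rewrite /expi cosD sinD; simpc; rewrite [_ * sin y + _]addrC.
Qed.

Lemma expi_sum (I : Type) (s : seq I) (f : I -> R) :
  expi (\sum_(i <- s) f i) = \prod_(i <- s) expi (f i).
Proof. exact: (big_morph _ expiD expi0). Qed.

Lemma normc_expi x : Normc.normc (expi x) = 1.
Proof. by rewrite /= cos2Dsin2 sqrtr1. Qed.

Lemma dist_sin_le x y : `|sin x - sin y| <= `|x - y|.
Proof.
wlog yx : x y / y <= x.
  by move=> H; have [/H//|/ltW/H] := leP y x; rewrite distrC [leRHS]distrC.
have [|c _ ->] := @MVT_segment R sin cos y x yx (fun c _ => is_derive_sin c).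
  by apply: continuous_subspaceT => ?; exact: continuous_sin.
by rewrite normrM ler_piMl// cos_max.
Qed.

Lemma onem_cos_le x : 0 <= 1 - cos x <= x ^+ 2 / 2.
Proof.
have -> : 1 - cos x = sin (x / 2) ^+ 2 * 2.
  rewrite [in cos x](_ : x = (x / 2) *+ 2); last by rewrite -mulr_natr divfK.
  by rewrite cos_mulr2n sin2cos2; ring.
have := dist_sin_le (x / 2) 0; rewrite sin0 !subr0 => H.
rewrite mulr_ge0 ?sqr_ge0//=.
have : sin (x / 2) ^+ 2 <= (x / 2) ^+ 2.
  by rewrite -real_normK ?num_real// -[leRHS]real_normK ?num_real// ler_sqr ?nnegrE.
by rewrite expr_div_n; lra.
Qed.

Lemma normc_expi_sub1 x : Normc.normc (expi x - 1) <= `|x|.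
Proof.
rewrite /= -sqrtr_sqr ler_wsqrtr//.
have := onem_cos_le x; have := cos2Dsin2 x.
rewrite sqrrB oppr0 addr0; nra.
Qed.

Lemma normc_expi_sub1_le2 x : Normc.normc (expi x - 1) <= 2.
Proof.
apply: le_trans (le_normcD _ _) _.
by rewrite normcN normc_expi Normc.normc1.
Qed.

Lemma normc_expi_sub2_le2 x :
  Normc.normc (expi (- x) - 1 + (0 +i* x)%C) <= 2 * `|x|.
Proof.
apply: le_trans (le_normcD _ _) _.
have := normc_expi_sub1 (- x); rewrite normrN.
by rewrite /= expr0n add0r sqrtr_sqr; lra.
Qed.

(** Mean value theorem: the derivative at c satisfies |1 - cos c| <= |exp(ic) - 1| <= |c| <= x. *)
Lemma dist_sin_id_le x : `|x - sin x| <= x ^+ 2.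
Proof.
wlog x0 : x / 0 <= x.
  move=> H; have [/H//|/ltW] := leP 0 x; rewrite -oppr_ge0 => /H.
  by rewrite sinN sqrrN opprK (addrC (- x)) distrC.
have [|c] := @MVT_segment R (fun x => x - sin x) (fun x => 1 - cos x) 0 x x0.
- apply: continuous_subspaceT => c; apply: cvgB; first exact: cvg_id.
  exact: continuous_sin.
rewrite in_itv/= => /andP[c0 cx]; rewrite sin0 !subr0 => ->.
rewrite normrM (ger0_norm x0) expr2 ler_wpM2r//.
have := normc_expi_sub1 c; rewrite (ger0_norm c0) => /le_trans/(_ cx).
apply: le_trans; rewrite distrC /= oppr0 addr0.
by rewrite -sqrtr_sqr ler_wsqrtr// lerDl sqr_ge0.
Qed.

(** The real and imaginary parts are at most x^2 / 2 and x^2. The constant 2 is generous but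
    harmless: it is used only off the tail event, where it multiplies a quantity that tends to 0
    with eps. The 2 of [normc_expi_sub2_le2] is the one that survives in the theorem. *)
Lemma normc_expi_sub2 x :
  Normc.normc (expi (- x) - 1 + (0 +i* x)%C) <= 2 * x ^+ 2.
Proof.
have -> : expi (- x) - 1 + (0 +i* x)%C = ((cos x - 1) +i* (x - sin x))%C.
  apply/eqP; rewrite eq_complex /expi cosN sinN /=.
  by apply/andP; split; apply/eqP; ring.
apply: le_trans (normc_le_add _ _) _.
have := dist_sin_id_le x; have /andP[? ?] := onem_cos_le x.
rewrite (distrC (cos x)) (ger0_norm (x := 1 - cos x))//.
by have := sqr_ge0 x; lra.
Qed.

End expi.

(** * From an approximate Gaussian equation to a bound on the characteristic function *)

Section characteristic_function_ode.
Context d (T : measurableType d) (R : realType) (P : probability T R).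
Variable S : T -> R.
Hypothesis mS : measurable_fun setT S.
Hypothesis iS : P.-integrable setT (fun w => (S w)%:E).

Lemma integrable_dominated (f g : T -> R) : measurable_fun setT f ->
  P.-integrable setT (fun w => (g w)%:E) -> (forall w, `|f w| <= `|g w|) ->
  P.-integrable setT (fun w => (f w)%:E).
Proof.
move=> mf ig fg; apply: le_integrable ig => //; first exact/measurable_EFinP.
by move=> w _; rewrite lee_fin.
Qed.

Lemma integrable_bounded (f : T -> R) (M : R) : measurable_fun setT f ->
  (forall w, `|f w| <= M) -> P.-integrable setT (fun w => (f w)%:E).
Proof.
move=> mf fM; apply: (@integrable_dominated _ (cst M)) => //.
  exact: finite_measure_integrable_cst.
by move=> w; rewrite (le_trans (fM w))// ler_norm.
Qed.

Lemma measurable_trig (h : R -> R) (u : T -> R) : continuous h ->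
  measurable_fun setT u -> measurable_fun setT (fun w => h (u w)).
Proof.
move=> ch mu; apply: measurableT_comp mu.
exact: continuous_measurable_fun.
Qed.

(** The integrable function |S| dominates the derivative of [h (r * S w)] in r, whatever r is, which
    permits differentiation under the integral sign. It is applied to cos and sin. *)
Lemma is_derive_Rintegral_trig (h dh : R -> R) (s : R) :
  (forall x : R, is_derive x 1 h (dh x)) -> (forall x, `|h x| <= 1) ->
  (forall x, `|dh x| <= 1) ->
  is_derive s 1 (fun r => \int[P]_w h (r * S w)) (\int[P]_w (dh (s * S w) * S w)).
Proof.
move=> hd h1 dh1.
have ch : continuous h.
  by move=> x; apply/differentiable_continuous/derivable1_diffP; exact: (@ex_derive _ _ _ _ _ _ _ (hd x)).
have df (r : R) w : is_derive r 1 (fun r => h (r * S w)) (dh (r * S w) * S w).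
  have d1 : is_derive r 1 (fun r : R => r * S w) (S w).
    by apply: is_derive_eq; rewrite scaler0 add0r scaler1.
  exact: (@is_derive1_comp _ h (fun r => r * S w) _ _ _ (hd _) d1).
pose f r w := h (r * S w).
pose J : set R := `]s - 1, s + 1[%classic.
have Is : J s by rewrite /J /= in_itv /=; lra.
have if_ x : J x -> P.-integrable setT (EFin \o f x).
  move=> _; apply: (@integrable_bounded _ 1) => [|w]; last exact: h1.
  by apply: measurable_trig => //; exact: measurable_funM.
have df1 x y : J x -> setT y -> derivable (f ^~ y) x 1.
  by move=> _ _; exact: ex_derive.
have iG : P.-integrable setT (EFin \o (fun w => `|S w|)).
  exact: integrable_norm.
have GS x y : J x -> setT y ->
    `|partial1of2 f x y| <= `|S y|.
  move=> _ _; rewrite partial1of2E derive_val normrM ler_piMl//.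
have dv : derivable (fun r => \int[P]_w f r w) s 1.
  exact: (derivable_under_integral measurableT Is if_ df1 (fun=> normr_ge0 _) iG GS).
apply: DeriveDef => //.
rewrite -derive1E (differentiation_under_integral measurableT Is if_ df1 (fun=> normr_ge0 _) iG GS).
apply: eq_Rintegral => w _.
by rewrite partial1of2E derive_val.
Qed.

Lemma Cexpectation_expi s : Cexpectation P (fun w => expi (- (s * S w))) =
  (\int[P]_w cos (s * S w) -i* \int[P]_w sin (s * S w))%C.
Proof.
rewrite CexpectationE /=; congr (_ +i* _)%C.
  by apply: eq_Rintegral => w _; rewrite cosN.
rewrite -[RHS]mulN1r -RintegralZl//.
  by apply: eq_Rintegral => w _; rewrite sinN mulN1r.
apply: (@integrable_bounded _ 1) => [|w]; last exact: sin_max.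
by apply: measurable_trig; [exact: continuous_sin|exact: measurable_funM].
Qed.

Lemma integrable_mul_sin s :
  P.-integrable setT (fun w => (sin (s * S w) * S w)%:E).
Proof.
apply: (@integrable_dominated _ S) => // [|w].
  apply: measurable_funM => //.
  by apply: measurable_trig; [exact: continuous_sin|exact: measurable_funM].
by rewrite normrM ler_piMl// sin_max.
Qed.

Lemma Cexpectation_mul_expi s :
  Cexpectation P (fun w => (S w)%:C%C * expi (- (s * S w))) =
  (\int[P]_w (cos (s * S w) * S w) -i* \int[P]_w (sin (s * S w) * S w))%C.
Proof.
rewrite CexpectationE /=; congr (_ +i* _)%C.
  by apply: eq_Rintegral => w _; rewrite cosN mul0r subr0 mulrC.
rewrite -[RHS]mulN1r -RintegralZl//.
  by apply: eq_Rintegral => w _; rewrite sinN mul0r addr0 mulN1r mulrN mulrC.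
exact: integrable_mul_sin.
Qed.

(** With f(s) = E[exp(-isS)] = a(s) - i b(s), the hypothesis bounds |i f' + i s tau f|, since
    E[S exp(-isS)] = i f'(s). Monotonicity arguments need real functions, so the modulus of the
    difference is tested against every unit direction (p, q). *)
Lemma dist_charfun_gauss (tau C : R) : 0 <= tau -> 0 <= C ->
  (forall s : R, 0 <= s <= 1 ->
    Normc.normc (Cexpectation P (fun w => (S w)%:C%C * expi (- (s * S w))) +
      (0 +i* (s * tau))%C * Cexpectation P (fun w => expi (- (s * S w)))) <=
    s * tau * C) ->
  Normc.normc (Cexpectation P (fun w => expi (- S w)) -
               (expR (- (tau / 2)))%:C%C) <= C.
Proof.
move=> tau0 C0 H.
pose a s := \int[P]_w cos (s * S w); pose b s := \int[P]_w sin (s * S w).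
pose a' s := \int[P]_w (sin (s * S w) * S w).
pose b' s := \int[P]_w (cos (s * S w) * S w).
have da (s : R) : is_derive s 1 a (- a' s).
  apply: is_derive_eq.
    apply: (@is_derive_Rintegral_trig cos (fun x => - sin x)) => x.
      exact: cos_max.
    by rewrite normrN sin_max.
  rewrite /a' -[RHS]mulN1r -RintegralZl//.
    by apply: eq_Rintegral => w _; rewrite mulNr mulN1r.
  exact: integrable_mul_sin.
have db (s : R) : is_derive s 1 b (b' s).
  by apply: is_derive_Rintegral_trig => x; [exact: sin_max|exact: cos_max].
have dir p q : p ^+ 2 + q ^+ 2 = 1 ->
    p * (a 1 - expR (- (tau / 2))) + q * b 1 <= C.
  move=> pq.
  (* G is nonincreasing, and G 1 <= G 0 is the bound in the direction (p, q). *)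
  pose G s := (p * a s + q * b s - C) * expR (s ^+ 2 * (tau / 2)).
  have dG (s : R) : is_derive s 1 G
     ((s * tau * (p * a s + q * b s) - p * a' s + q * b' s - s * tau * C)
      * expR (s ^+ 2 * (tau / 2))).
    have dp : is_derive s 1 (fun s : R => s ^+ 2 * (tau / 2)) (s * tau).
      by apply: is_derive_eq; rewrite /GRing.scale/=; field.
    have dE := @is_derive1_comp _ expR _ _ _ _ (is_derive_expR _) dp.
    have dL : is_derive s 1 (fun s : R => p * a s + q * b s - C) (p * (- a' s) + q * b' s).
      by apply: is_derive_eq; rewrite /GRing.scale/=; ring.
    by apply: (is_derive_eq (is_deriveM dL dE)); rewrite /GRing.scale /=; ring.
  have G10 : G 1 <= G 0.
    apply: (@ler0_derive1_nincr _ G 0 1) => //.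
    - move=> x; rewrite in_itv/= => /andP[x0 x1].
      rewrite derive1E derive_val mulr_le0_ge0 ?expR_ge0//.
      have := H x; rewrite (ltW x0) (ltW x1) => /(_ isT) {}H.
      rewrite subr_le0; apply: le_trans H.
      rewrite Cexpectation_mul_expi Cexpectation_expi -/(a x) -/(b x) -/(a' x) -/(b' x).
      rewrite /= !mul0r.
      set u := b' x + (0 - _); set v := - a' x + (0 + _); set k := (X in X <= _).
      have -> : k = q * u + p * v by rewrite /k /u /v; ring.
      apply: (le_trans (ler_norm _)); rewrite -sqrtr_sqr ler_wsqrtr//.
      (* Cauchy-Schwarz in the plane: (q u + p v)^2 + (q v - p u)^2 = (p^2 + q^2)(u^2 + v^2). *)
      have := sqr_ge0 (q * v - p * u).
      have -> : u ^+ 2 + v ^+ 2 = (p ^+ 2 + q ^+ 2) * (u ^+ 2 + v ^+ 2) by rewrite pq mul1r.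
      by move: u v => {}u {}v; nra.
    - apply: continuous_subspaceT => x.
      by apply/differentiable_continuous/derivable1_diffP; exact: (@ex_derive _ _ _ _ _ _ _ (dG x)).
  move: G10; rewrite /G expr0n /= mul0r expR0 mulr1 expr1n mul1r.
  have -> : a 0 = 1.
    rewrite /a; under eq_Rintegral do rewrite mul0r cos0.
    by rewrite Rintegral_cst// mul1r [X in fine X]probability_setT.
  have -> : b 0 = 0.
    rewrite /b; under eq_Rintegral do rewrite mul0r sin0.
    by rewrite Rintegral_cst// mul0r.
  rewrite mulr0 mulr1 addr0 expRN; set E := expR (tau / 2).
  have E0 : 0 < E by exact: expR_gt0.
  have E1 : 1 <= E by rewrite -expR0 ler_expR divr_ge0.
  (* [K] bounds p a(1) + q b(1) - C by (p - C) / E; rearranged, the pairing is at most C (1 - 1/E),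
     and 1/E lies in (0, 1]. *)
  rewrite -ler_pdivlMr// => K.
  have EV : 0 < E^-1 by rewrite invr_gt0.
  by nra.
have -> : (fun w => expi (- S w)) = (fun w => expi (- (1 * S w))).
  by apply/funext => w; rewrite mul1r.
rewrite Cexpectation_expi -/(a 1) -/(b 1).
set z := _ - _.
have [->|z0] := eqVneq (Normc.normc z) 0; first by [].
have zE : z = ((a 1 - expR (- (tau / 2))) -i* b 1)%C.
  by apply/eqP; rewrite eq_complex /= oppr0 addr0 !eqxx.
pose x := a 1 - expR (- (tau / 2)).
have m2 : x * x + b 1 * b 1 = Normc.normc z ^+ 2.
  by rewrite Re_conj_mul zE /x /=; ring.
move: z0 m2; move: (Normc.normc z) => m m0 m2.
(* In this direction the pairing equals the modulus of [z]. *)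
have := dir (x / m) (b 1 / m); rewrite -/x.
have -> : x / m * x + b 1 / m * b 1 = m.
  by apply: (mulIf m0); rewrite -expr2 -m2; field.
apply; rewrite !expr_div_n -mulrDl !expr2 m2 divff//.
by rewrite mulf_neq0.
Qed.
End characteristic_function_ode.

(** * Stein's identity and the normal characteristic function *)

Section integral_of_derivative.
Context {R : realType}.
Notation mu := (@lebesgue_measure R).

(** The integral over [-(n+1), n+1] is F(n+1) - F(-(n+1)), and dominated convergence with bound |f|
    carries this to the whole line. The successor keeps the endpoints strictly ordered when n =
    0. *)
Lemma Rintegral_derive_eq0 (F f : R -> R) :
  (forall x : R, is_derive x 1 F (f x)) -> continuous f ->
  mu.-integrable setT (EFin \o f) ->
  F n.+1%:R @[n --> \oo] --> 0 -> F (- n.+1%:R) @[n --> \oo] --> 0 ->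
  \int[mu]_x f x = 0.
Proof.
move=> dF cf intf F1 F2.
pose fn n : R -> \bar R := (EFin \o f) \_ `[- n.+1%:R, n.+1%:R]%classic.
have mf : measurable_fun setT f by exact: continuous_measurable_fun.
have dom : [/\ mu.-integrable setT (EFin \o f),
    (\int[mu]_x `|fn n x - (f x)%:E|)%E @[n --> \oo] --> 0%E &
    (\int[mu]_x fn n x)%E @[n --> \oo] --> (\int[mu]_x (f x)%:E)%E].
  apply: (@dominated_convergence _ _ _ mu setT measurableT fn (EFin \o f)
    (fun x => `|(f x)%:E|%E)).
  - move=> n; apply/(measurable_restrictT _ _).1 => //.
    by apply: measurable_funTS; exact/measurable_EFinP.
  - exact/measurable_EFinP.
  - apply: aeW => x _; apply: cvg_near_cst.
    near=> n; rewrite /fn patchE mem_set//= in_itv/= -ler_norml.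
    rewrite (@le_trans _ _ n%:R) ?ler_nat//.
    by near: n; exact: nbhs_infty_ger.
  - exact: integrable_abse.
  - by apply: aeW => x n _; rewrite /fn patchE; case: ifPn => //; rewrite abse0.
have [_ _] := dom.
have -> : (fun n => \int[mu]_x fn n x)%E = EFin \o (fun n => F n.+1%:R - F (- n.+1%:R)).
  apply/funext => n; rewrite -integral_mkcond.
  have cF x : {for x, continuous F}.
    by apply/differentiable_continuous/derivable1_diffP; exact: (@ex_derive _ _ _ _ _ _ _ (dF x)).
  rewrite /comp (@continuous_FTC2 _ f F)//.
  - by rewrite (@lt_trans _ _ 0)// oppr_lt0.
  - by apply: continuous_subspaceT => x; exact: cf.
  - split.
    + by move=> x _; exact: (@ex_derive _ _ _ _ _ _ _ (dF x)).
    + exact/cvg_at_right_filter/cF.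
    + exact/cvg_at_left_filter/cF.
  - by move=> x _; rewrite derive1E; exact: (@derive_val _ _ _ _ _ _ _ (dF x)).
have : EFin \o (fun n => F n.+1%:R - F (- n.+1%:R)) @ \oo --> 0%:E.
  apply: cvg_EFin; first exact: nearW.
  by rewrite -[0 in X in _ --> X]subr0; exact: cvgB.
move=> H0 /(cvg_unique _ H0) H.
by rewrite /Rintegral -H.
Unshelve. all: by end_near. Qed.

End integral_of_derivative.

Section normal.
Context {R : realType}.
Notation mu := (@lebesgue_measure R).
Notation pdf := (@normal_pdf R 0 1).

Lemma is_derive_normal_pdf (x : R) : is_derive x 1 pdf (- x * pdf x).
Proof.
have E : pdf = (fun x => normal_peak 1 * expR (- (x ^+ 2) / 2)).
  rewrite normal_pdfE ?oner_neq0//; apply/funext => y.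
  by rewrite /normal_fun subr0 expr1n.
rewrite E.
have d1 : is_derive x 1 (fun x : R => - (x ^+ 2) / 2) (- x).
  by apply: is_derive_eq; rewrite /GRing.scale/=; field.
have d2 := @is_derive1_comp _ expR _ _ _ _ (is_derive_expR _) d1.
have d3 := is_deriveZ (normal_peak 1) d2.
by apply: (is_derive_eq d3); rewrite /GRing.scale/=; ring.
Qed.

(* Since [|x| <= 1 + 3 x^2 / 8 <= exp (3 x^2 / 8)]. *)
Lemma norm_mul_normal_pdf_le (x : R) :
  `|x * pdf x| <= normal_peak 1 * (normal_peak 2)^-1 * normal_pdf 0 2 x.
Proof.
have n2 : (2 : R) != 0 by rewrite pnatr_eq0.
rewrite !normal_pdfE ?oner_neq0// mulrA -[_ / _ * _]mulrA mulVf; last first.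
  by rewrite gt_eqF// normal_peak_gt0.
rewrite mulr1 normrM normrM (ger0_norm (normal_peak_ge0 _)) (ger0_norm (normal_fun_ge0 _ _ _)).
rewrite mulrCA ler_wpM2l ?normal_peak_ge0// /normal_fun subr0 expr1n.
(* The density of standard deviation 2 has exponent -x^2 / 8; the remaining -3 x^2 / 8 absorbs the
   factor |x|. *)
have -> : - x ^+ 2 / 2 = - x ^+ 2 / (2 ^+ 2 *+ 2) - x ^+ 2 * (3 / 8).
  by field.
rewrite expRD mulrCA ler_piMr ?expR_ge0// expRN ler_pdivrMr ?expR_gt0// mul1r.
apply: le_trans (expR_ge1Dx _).
have := sqr_ge0 (3 / 4 * `|x| - 1).
by rewrite -(real_normK (num_real x)); move: `|x| => u; nra.
Qed.

(** Since |x pdf(x)| is at most [normal_peak 1], the density at distance n+1 from 0 is at most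
    [normal_peak 1] / (n+1). The sign s covers both ends of the line. *)
Lemma mul_normal_pdf_cvg0 (h : R -> R) (s : R) : (forall x, `|h x| <= 1) ->
  `|s| = 1 -> h (s * n.+1%:R) * pdf (s * n.+1%:R) @[n --> \oo] --> 0.
Proof.
move=> h1 s1; apply/norm_cvg0P.
apply: (@squeeze_cvgr _ _ _ _ (fun=> 0) (fun n => normal_peak 1 * harmonic n)).
- apply: nearW => n; rewrite normr_ge0/= normrM.
  rewrite (@le_trans _ _ `|pdf (s * n.+1%:R)|) ?ler_piMl//.
  rewrite /harmonic/= ler_pdivlMr// mulrC.
  have := norm_mul_normal_pdf_le (s * n.+1%:R).
  rewrite 2!normrM s1 mul1r normr_nat => /le_trans; apply.
  rewrite -mulrA ler_piMr ?normal_peak_ge0//.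
  by rewrite ler_pdivrMl ?mulr1 ?normal_pdf_ub ?normal_peak_gt0 ?pnatr_eq0.
- exact: cvg_cst.
- by rewrite -[0 in X in _ --> X](mulr0 (normal_peak 1)); apply: cvgMr; exact: cvg_harmonic.
Qed.

Lemma integrable_mul_normal_pdf (h : R -> R) : continuous h ->
  (forall x, `|h x| <= 1) -> mu.-integrable setT (fun x => (h x * pdf x)%:E).
Proof.
move=> ch h1; have := integrable_normal_pdf (0 : R) 1.
apply: le_integrable => //.
  apply/measurable_EFinP/measurable_funM; last exact: measurable_normal_pdf.
  exact: continuous_measurable_fun.
by move=> x _; rewrite lee_fin normrM ler_piMl.
Qed.

Lemma integrable_id_mul_normal_pdf (h : R -> R) : continuous h ->
  (forall x, `|h x| <= 1) -> mu.-integrable setT (fun x => (x * h x * pdf x)%:E).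
Proof.
move=> ch h1; have := integrableZl measurableT (normal_peak 1 * (normal_peak 2)^-1)
  (integrable_normal_pdf (0 : R) 2).
apply: le_integrable => //.
  apply/measurable_EFinP/measurable_funM; last exact: measurable_normal_pdf.
  by apply: measurable_funM => //; exact: continuous_measurable_fun.
move=> x _; rewrite -EFinM lee_fin [leRHS]ger0_norm; last first.
  by rewrite mulr_ge0 ?normal_pdf_ge0 ?divr_ge0 ?normal_peak_ge0.
apply: le_trans (norm_mul_normal_pdf_le x).
by rewrite mulrAC normrM ler_piMr.
Qed.

(* The integrand of the difference is the derivative of [h (r x) * pdf x], which
   vanishes at infinity. *)
Lemma stein_normal (h dh : R -> R) (r : R) :
  (forall x : R, is_derive x 1 h (dh x)) -> continuous dh ->
  (forall x, `|h x| <= 1) -> (forall x, `|dh x| <= 1) ->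
  \int[mu]_x (x * h (r * x) * pdf x) = r * \int[mu]_x (dh (r * x) * pdf x).
Proof.
move=> hd cdh h1 dh1.
have ch : continuous h.
  move=> x; apply/differentiable_continuous/derivable1_diffP.
  exact: (@ex_derive _ _ _ _ _ _ _ (hd x)).
have cr (k : R -> R) : continuous k -> continuous (fun x => k (r * x)).
  move=> ck x; apply: (continuous_comp (f := fun x => r * x) (g := k)).
    exact: mulrl_continuous.
  exact: ck.
have i1 := integrable_id_mul_normal_pdf (cr _ ch) (fun x => h1 _).
have i2 := integrable_mul_normal_pdf (cr _ cdh) (fun x => dh1 _).
apply/eqP; rewrite eq_sym -subr_eq0 -RintegralZl// -RintegralB//; last first.
  by rewrite /comp; under eq_fun do rewrite EFinM; exact: integrableZl.
apply/eqP; apply: (@Rintegral_derive_eq0 _ (fun x => h (r * x) * pdf x)).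
- move=> x; have d1 : is_derive x 1 (fun x : R => r * x) r.
    by apply: is_derive_eq; rewrite /GRing.scale/=; ring.
  have d2 := @is_derive1_comp _ h _ _ _ _ (hd _) d1.
  apply: (is_derive_eq (is_deriveM d2 (is_derive_normal_pdf x))).
  by rewrite /GRing.scale/=; ring.
- move=> x; apply: cvgB; apply: cvgM.
  + exact: cvg_cst.
  + apply: cvgM; first exact: cr.
    by apply: continuous_normal_pdf; rewrite oner_neq0.
  + by apply: cvgM; [exact: cvg_id|exact: cr].
  + by apply: continuous_normal_pdf; rewrite oner_neq0.
- rewrite /comp; under eq_fun do rewrite EFinB EFinM.
  by apply: integrableB => //; exact: integrableZl.
- have := @mul_normal_pdf_cvg0 (fun x => h (r * x)) 1 (fun x => h1 _) (normr1 _).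
  by under eq_fun do rewrite mul1r.
- have := @mul_normal_pdf_cvg0 (fun x => h (r * x)) (- 1) (fun x => h1 _).
  rewrite normrN1 => /(_ erefl).
  by under eq_fun do rewrite mulN1r.
Qed.

End normal.

Section standard_normal_variable.
Context d (T : measurableType d) (R : realType) (P : probability T R).
Notation mu := (@lebesgue_measure R).
Notation pdf := (@normal_pdf R 0 1).
Variable X : T -> measurableTypeR R.
Hypothesis mX : measurable_fun setT X.
Hypothesis nX : forall B : set (measurableTypeR R), measurable B ->
  P (X @^-1` B) = normal_prob 0 1 B.

Lemma ge0_integral_normal (f : R -> R) : measurable_fun setT f ->
  (forall x, 0 <= f x) ->
  (\int[P]_w (f (X w))%:E = \int[mu]_x (f x * pdf x)%:E)%E.
Proof.
move=> mf f0.
(* Here Lebesgue measure with density [pdf] and the identity map stand on one side, [P] and [X] on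
   the other, with C = 1. *)
have := @ge0_integral_transfer _ _ (measurableTypeR R) T _ (measurableTypeR R) R
  mu P id X pdf 1 (@measurable_id _ _ _) mX (measurable_normal_pdf _ _)
  (normal_pdf_ge0 _ _) _ (EFin \o f).
rewrite mul1e /= => <-.
- by apply: eq_integral => x _; rewrite -EFinM mulrC.
- move=> B mB; rewrite mul1e nX// /normal_prob [RHS]integral_mkcond.
  apply: eq_integral => x _; rewrite patchE indicE.
  by case: ifP; rewrite ?mulr1 ?mulr0.
- exact/measurable_EFinP.
- by move=> x; rewrite lee_fin.
Qed.

Lemma Rintegral_normal (f : R -> R) : measurable_fun setT f ->
  mu.-integrable setT (fun x => (f x * pdf x)%:E) ->
  P.-integrable setT (fun w => (f (X w))%:E) /\
  \int[P]_w f (X w) = \int[mu]_x (f x * pdf x).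
Proof.
move=> mf ifp.
have mfX : measurable_fun setT (fun w => (f (X w))%:E).
  by apply/measurable_EFinP; exact: measurableT_comp.
have iX : P.-integrable setT (fun w => (f (X w))%:E).
  apply/integrableP; split => //.
  under eq_integral do rewrite abse_EFin.
  rewrite (ge0_integral_normal (f := fun x => `|f x|))//; last exact: measurableT_comp.
  have /integrableP[_] := ifp; congr (_ < _)%E; apply: eq_integral => x _.
  by rewrite abse_EFin normrM (ger0_norm (normal_pdf_ge0 _ _ _)).
split => //; rewrite /Rintegral integralE [in RHS]integralE; congr (fine (_ - _)%E).
  transitivity (\int[P]_w (Num.max (f (X w)) 0)%:E)%E.
    by apply: eq_integral => w _; rewrite funeposE -EFin_max.
  rewrite (ge0_integral_normal (f := fun x => Num.max (f x) 0)).
  - apply: eq_integral => x _; rewrite funeposE -EFin_max maxr_pMl ?mul0r//.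
    exact: normal_pdf_ge0.
  - exact: measurable_maxr.
  - by move=> x; rewrite le_max lexx orbT.
transitivity (\int[P]_w (Num.max (- f (X w)) 0)%:E)%E.
  by apply: eq_integral => w _; rewrite funenegE -EFinN -EFin_max.
rewrite (ge0_integral_normal (f := fun x => Num.max (- f x) 0)).
- apply: eq_integral => x _; rewrite funenegE -EFinN -EFin_max maxr_pMl ?mul0r ?mulNr//.
  exact: normal_pdf_ge0.
- by apply: measurable_maxr => //; exact: measurableT_comp.
- by move=> x; rewrite le_max lexx orbT.
Qed.

Lemma charfun_standard_normal (r : R) :
  Cexpectation P (fun w => expi (- (r * X w))) = (expR (- (r ^+ 2 / 2)))%:C%C.
Proof.
have cr (k : R -> R) (u : R) : continuous k -> continuous (fun x : R => k (u * x)).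
  move=> ck x; apply: (continuous_comp (f := fun x : R => u * x) (g := k)).
    exact: mulrl_continuous.
  exact: ck.
have st (h dh : R -> R) (u : R) : (forall x : R, is_derive x 1 h (dh x)) ->
    continuous dh -> (forall x, `|h x| <= 1) -> (forall x, `|dh x| <= 1) ->
    P.-integrable setT (fun w => (X w * h (u * X w))%:E) /\
    \int[P]_w (X w * h (u * X w)) = u * \int[P]_w dh (u * X w).
  move=> hd cdh h1 dh1.
  have ch : continuous h.
    move=> x; apply/differentiable_continuous/derivable1_diffP.
    exact: (@ex_derive _ _ _ _ _ _ _ (hd x)).
  have [||i1 ->] := @Rintegral_normal (fun x => x * h (u * x)).
  - by apply: measurable_funM => //; apply: continuous_measurable_fun; exact: cr.
  - by apply: integrable_id_mul_normal_pdf => //; exact: cr.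
  split => //; rewrite (stein_normal _ hd)//; congr (_ * _).
  have [||_ ->//] := @Rintegral_normal (fun x => dh (u * x)).
  - by apply: continuous_measurable_fun; exact: cr.
  - by apply: integrable_mul_normal_pdf => //; exact: cr.
have mX' : measurable_fun setT (X : T -> R) by [].
have mS : measurable_fun setT (fun w => r * X w : R) by exact: measurable_funM.
have iS : P.-integrable setT (fun w => (r * X w)%:E).
  have [| |i1 _] := @Rintegral_normal (fun x => x * 1).
  - exact: measurable_funM.
  - apply: (@integrable_id_mul_normal_pdf _ (fun=> 1)) => [x|x].
      exact: cvg_cst.
    by rewrite normr1.
  under eq_fun do rewrite -[X _]mulr1 EFinM.
  by apply: integrableZl => //; exact: i1.
apply/eqP; rewrite -subr_eq0; apply/eqP/Normc.eq0_normc/eqP.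
rewrite eq_le normc_ge0 andbT.
(* With C = 0 it remains to show that S = rX satisfies the Gaussian equation exactly, for tau = r^2.
   Stein's identity for cos and sin gives E[S exp(-isS)] = -i s r^2 E[exp(-isS)]. *)
apply: (dist_charfun_gauss mS iS (sqr_ge0 r) (lexx 0)) => s _.
rewrite mulr0 Cexpectation_mul_expi// Cexpectation_expi//.
have csin : continuous (fun x : R => - sin x).
  by move=> x; apply: cvgN; exact: continuous_sin.
have [||i1 Ec] := st cos (fun x => - sin x) (s * r) (@is_derive_cos R) csin.
- exact: cos_max.
- by move=> x; rewrite normrN; exact: sin_max.
have [||i2 Es] := st sin cos (s * r) (@is_derive_sin R) (@continuous_cos R).
- exact: sin_max.
- exact: cos_max.
have E1 (h : R -> R) : P.-integrable setT (fun w => (X w * h (s * r * X w))%:E) ->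
    \int[P]_w (h (s * (r * X w)) * (r * X w)) = r * \int[P]_w (X w * h (s * r * X w)).
  move=> ih; rewrite -RintegralZl//; apply: eq_Rintegral => w _.
  by rewrite (mulrA s r); ring.
rewrite !E1// Ec Es.
have -> : \int[P]_w (- sin (s * r * X w)) = - \int[P]_w sin (s * (r * X w)).
  rewrite -[RHS]mulN1r -RintegralZl//.
    by apply: eq_Rintegral => w _; rewrite mulN1r (mulrA s r).
  apply: (@integrable_bounded _ _ _ P _ 1) => [|w]; last exact: sin_max.
  by apply: measurable_trig; [exact: continuous_sin|exact: measurable_funM].
have -> : \int[P]_w cos (s * r * X w) = \int[P]_w cos (s * (r * X w)).
  by apply: eq_Rintegral => w _; rewrite (mulrA s r).
set u := \int[P]_w _; set v := \int[P]_w _.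
rewrite le_eqVlt; apply/orP; left; apply/eqP; rewrite -[RHS](@Normc.normc0 R).
congr Normc.normc; apply/eqP; rewrite eq_complex /=.
by apply/andP; split; apply/eqP; ring.
Qed.

End standard_normal_variable.

Lemma ler_normc_sum (R : rcfType) (I : Type) (s : seq I) (F : I -> R[i]) (G : I -> R) :
  (forall i, Normc.normc (F i) <= G i) ->
  Normc.normc (\sum_(i <- s) F i) <= \sum_(i <- s) G i.
Proof.
move=> FG; apply: (big_ind2 (fun z x => Normc.normc z <= x)) => //.
  by rewrite Normc.normc0.
by move=> z x z' x' zx zx'; apply: (le_trans (le_normcD _ _)); exact: lerD.
Qed.

Lemma Rintegral_sum d (T : measurableType d) (R : realType)
    (P : probability T R) (I : Type) (s : seq I) (f : I -> T -> R) :
  (forall i, P.-integrable setT (fun w => (f i w)%:E)) ->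
  \int[P]_w (\sum_(i <- s) f i w) = \sum_(i <- s) \int[P]_w f i w.
Proof.
move=> fi; rewrite /Rintegral; under eq_integral do rewrite -sumEFin.
rewrite integral_sum// -sum_fine// => i _.
by apply: integrable_fin_num => //; exact: fi.
Qed.

(** * Rows of independent centred scalar variables *)

Section orthogonal_row.
Context d d' (T : measurableType d) (T' : measurableType d') (R : realType).
Context (P : probability T R) (I : finType) (X : I -> T -> T').
Hypothesis mX : forall i, measurable_fun setT (X i).
Hypothesis indX : mutually_independent P X.
Variable g : T' -> R.
Hypothesis mg : measurable_fun setT g.
Hypothesis sqY : forall i, P.-integrable setT (fun w => (g (X i w) ^+ 2)%:E).
Hypothesis meanY : forall i, \int[P]_w g (X i w) = 0.

Let mgX i : measurable_fun setT (fun w => g (X i w)).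
Proof. exact: measurableT_comp. Qed.

Lemma integrable_square i : P.-integrable setT (fun w => (g (X i w))%:E).
Proof.
apply: (@integrable_dominated _ _ _ _ _ (fun w => 1 + g (X i w) ^+ 2)) => //.
  under eq_fun do rewrite EFinD.
  apply: integrableD => //.
  exact: (finite_measure_integrable_cst P 1 measurableT).
move=> w; rewrite [leRHS]ger0_norm ?addr_ge0 ?sqr_ge0//.
by rewrite -(real_normK (num_real (g _))); have := sqr_ge0 (`|g (X i w)| - 1); nra.
Qed.

(** Independence and centring kill the cross terms. This identifies tau, a sum over entries, with
    the variance of the row sum, which is what the covariance condition prescribes. *)
Lemma orthogonal_row : \sum_i \int[P]_w g (X i w) ^+ 2 =
  \int[P]_w (\sum_i g (X i w)) ^+ 2.
Proof.
have iXY i j : P.-integrable setT (fun w => (g (X i w) * g (X j w))%:E).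
  apply: (@integrable_dominated _ _ _ _ _ (fun w => g (X i w) ^+ 2 + g (X j w) ^+ 2)).
  - exact: measurable_funM.
  - by under eq_fun do rewrite EFinD; exact: integrableD.
  move=> w; rewrite [leRHS]ger0_norm ?addr_ge0 ?sqr_ge0// normrM.
  rewrite -(real_normK (num_real (g (X i w)))) -(real_normK (num_real (g (X j w)))).
  have := sqr_ge0 (`|g (X i w)| - `|g (X j w)|).
  by have := normr_ge0 (g (X i w)); have := normr_ge0 (g (X j w)); nra.
have XY0 i j : i != j -> \int[P]_w (g (X i w) * g (X j w)) = 0.
  (* Factors equal to 1 away from i and j reduce the full product to Y_i Y_j, so its expectation
     contains E[Y_i] = 0 as a factor. *)
  move=> ij; pose G k x : R[i] := if (k == i) || (k == j) then (g x)%:C%C else 1.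
  have := @Cintegrable_prod _ _ _ _ _ P I X mX indX G.
  have mRe k : measurable_fun setT (fun x => complex.Re (G k x)).
    by rewrite /G; case: (_ || _) => //=; exact: measurable_cst.
  have mIm k : measurable_fun setT (fun x => complex.Im (G k x)).
    by rewrite /G; case: (_ || _) => //=; exact: measurable_cst.
  have iG k : Cintegrable P (fun w => G k (X k w)).
    rewrite /G; case: (_ || _) => //=.
      by apply: Cintegrable_real; exact: integrable_square.
    by split; exact: (finite_measure_integrable_cst P _ measurableT).
  move=> /(_ mRe mIm iG)[_].
  have -> : (fun w => \prod_k G k (X k w)) = (fun w => (g (X i w) * g (X j w))%:C%C).
    apply/funext => w; rewrite (bigD1 i)//= (bigD1 j) 1?eq_sym//= big1 ?mulr1.
      by rewrite /G !eqxx orbT /= rmorphM.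
    by move=> k /andP[/negPf ki /negPf kj]; rewrite /G ki kj.
  rewrite Cexpectation_real (bigD1 i)//=.
  have -> : Cexpectation P (fun w => G i (X i w)) = 0.
    by rewrite /G eqxx /= Cexpectation_real meanY.
  by rewrite mul0r => -[].
under [RHS]eq_Rintegral => w _.
  rewrite expr2 mulr_suml.
  under eq_bigr do rewrite mulr_sumr.
  over.
rewrite Rintegral_sum; last first.
  move=> i; under eq_fun do rewrite -sumEFin.
  by apply: integrable_sum => // j _; exact: iXY.
apply: eq_bigr => i _; rewrite Rintegral_sum// (bigD1 i)//= [X in _ + X]big1 ?addr0.
  by apply: eq_Rintegral => w _; rewrite expr2.
by move=> j ji; rewrite XY0// eq_sym.
Qed.

End orthogonal_row.

Section independent_row.
Context d d' (T : measurableType d) (T' : measurableType d') (R : realType).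
Context (P : probability T R) (I : finType) (X : I -> T -> T').
Hypothesis mX : forall i, measurable_fun setT (X i).
Hypothesis indX : mutually_independent P X.
Variables (g : T' -> R) (B : set T').
Hypothesis mg : measurable_fun setT g.
Hypothesis mB : measurable B.
Hypothesis sqY : forall i, P.-integrable setT (fun w => (g (X i w) ^+ 2)%:E).
Hypothesis meanY : forall i, \int[P]_w g (X i w) = 0.
(** In the application [g] is <t, .>, [B] is the event |x| > eps, [e] is |t| eps, [l] bounds the
    Lindeberg sum and [M] bounds the probabilities of [B]. The tail is measured relative to [tau],
    so that [l] is free of t. *)
Variables (e l M : R).
Hypothesis gB : forall x, ~ B x -> `|g x| <= e.
Let tau := \sum_i \int[P]_w g (X i w) ^+ 2.
Hypothesis tailY :
  \sum_i \int[P]_w (g (X i w) ^+ 2 * \1_B (X i w)) <= tau * l.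
Hypothesis PB : forall i, fine (P (X i @^-1` B)) <= M.
Hypotheses (e0 : 0 <= e) (l0 : 0 <= l) (M0 : 0 <= M).

Let mgX i : measurable_fun setT (fun w => g (X i w)).
Proof. exact: measurableT_comp. Qed.

Let iY i : P.-integrable setT (fun w => (g (X i w))%:E).
Proof. exact: (integrable_square mX mg sqY). Qed.

Let iB i : P.-integrable setT (fun w => (\1_B (X i w))%:E : \bar R).
Proof.
apply: (@integrable_bounded _ _ _ P _ 1); first exact: measurableT_comp.
by move=> w; rewrite indicE normr_nat lern1 leq_b1.
Qed.

Let iYB i : P.-integrable setT (fun w => (g (X i w) ^+ 2 * \1_B (X i w))%:E).
Proof.
apply: (@integrable_dominated _ _ _ P _ (fun w => g (X i w) ^+ 2)) => //.
  apply: measurable_funM; first exact: measurable_funX.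
  exact: measurableT_comp.
by move=> w; rewrite normrM ler_piMr// indicE normr_nat lern1 leq_b1.
Qed.

Let mcos (s : R) : measurable_fun setT (fun x => cos (- (s * g x))).
Proof.
apply: measurableT_comp.
  by apply: continuous_measurable_fun; exact: continuous_cos.
by apply: measurableT_comp => //; exact: measurable_funM.
Qed.

Let msin (s : R) : measurable_fun setT (fun x => sin (- (s * g x))).
Proof.
apply: measurableT_comp.
  by apply: continuous_measurable_fun; exact: continuous_sin.
by apply: measurableT_comp => //; exact: measurable_funM.
Qed.

Let cE (s : R) i : Cintegrable P (fun w => expi (- (s * g (X i w)))).
Proof.
split => /=.
  apply: (@integrable_bounded _ _ _ P _ 1); last by move=> w; exact: cos_max.
  exact: (measurableT_comp (mcos s)).
apply: (@integrable_bounded _ _ _ P _ 1); last by move=> w; exact: sin_max.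
exact: (measurableT_comp (msin s)).
Qed.

Let cZ (s : R) i :
  Cintegrable P (fun w => (g (X i w))%:C%C * expi (- (s * g (X i w)))).
Proof.
split => /=.
  apply: (@integrable_dominated _ _ _ P _ (fun w => g (X i w))) => // [|w].
    apply: measurable_funB; last by apply: measurable_funM => //; exact: (measurableT_comp (msin s)).
    by apply: measurable_funM => //; exact: (measurableT_comp (mcos s)).
  by rewrite mul0r subr0 normrM ler_piMr// cos_max.
apply: (@integrable_dominated _ _ _ P _ (fun w => g (X i w))) => // [|w].
  apply: measurable_funD; last by apply: measurable_funM => //; exact: (measurableT_comp (mcos s)).
  by apply: measurable_funM => //; exact: (measurableT_comp (msin s)).
by rewrite mul0r addr0 normrM ler_piMr// sin_max.
Qed.

Let phi s i := Cexpectation P (fun w => expi (- (s * g (X i w)))).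
Let zeta s i := Cexpectation P (fun w => (g (X i w))%:C%C * expi (- (s * g (X i w)))).
Let S w := \sum_i g (X i w).

Let expi_S s w : expi (- (s * S w)) = \prod_i expi (- (s * g (X i w))).
Proof. by rewrite mulr_sumr -sumrN expi_sum. Qed.

Lemma charfun_row s : Cexpectation P (fun w => expi (- (s * S w))) = \prod_i phi s i.
Proof.
under [X in Cexpectation P X]eq_fun do rewrite expi_S.
by have [] := Cintegrable_prod mX indX (g := fun=> fun x => expi (- (s * g x)))
  (fun=> mcos s) (fun=> msin s) (cE s).
Qed.

Lemma mul_charfun_row s :
  Cexpectation P (fun w => (S w)%:C%C * expi (- (s * S w))) =
  \sum_k zeta s k * \prod_(i | i != k) phi s i.
Proof.
pose G (k i : I) x : R[i] := if i == k then (g x)%:C%C * expi (- (s * g x)) else expi (- (s * g x)).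
have E w : (S w)%:C%C * expi (- (s * S w)) = \sum_k \prod_i G k i (X i w).
  rewrite expi_S rmorph_sum mulr_suml; apply: eq_bigr => k _.
  rewrite (bigD1 k)//= [RHS](bigD1 k)//= {1}/G eqxx mulrA; congr (_ * _).
  by apply: eq_bigr => i /negPf ik; rewrite /G ik.
have H k : Cintegrable P (fun w => \prod_i G k i (X i w)) /\
    Cexpectation P (fun w => \prod_i G k i (X i w)) =
    \prod_i Cexpectation P (fun w => G k i (X i w)).
  apply: (Cintegrable_prod mX indX (g := G k)) => i; rewrite /G; case: (i == k) => /=.
  - by apply: measurable_funB; apply: measurable_funM.
  - exact: mcos.
  - by apply: measurable_funD; apply: measurable_funM.
  - exact: msin.
  - exact: cZ.
  - exact: cE.
under [X in Cexpectation P X]eq_fun do rewrite E.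
rewrite Cexpectation_sum; last by move=> k; exact: (H k).1.
apply: eq_bigr => k _; rewrite (H k).2 (bigD1 k)//=; congr (_ * _).
  by rewrite /G eqxx.
by apply: eq_bigr => i /negPf ik; rewrite /G ik.
Qed.

Lemma normc_charfun_le1 s i : Normc.normc (phi s i) <= 1.
Proof.
have := @le_normc_Cexpectation _ _ _ P _ (fun=> 1) (cE s i) _ _.
rewrite Rintegral_cst// mul1r [X in fine X]probability_setT; apply.
  exact: (finite_measure_integrable_cst P 1 measurableT).
by move=> w; rewrite normc_expi.
Qed.

(** The integrand exp(-isY) - 1 has modulus at most 2 on [B] and at most s|Y| <= e off [B]. *)
Lemma normc_charfun_sub1 s i : 0 <= s <= 1 ->
  Normc.normc (phi s i - 1) <= e + 2 * M.
Proof.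
move=> /andP[s0 s1].
have c1 : Cintegrable P (fun=> - 1 : R[i]).
  by split; exact: (finite_measure_integrable_cst P _ measurableT).
have -> : phi s i - 1 = Cexpectation P (fun w => expi (- (s * g (X i w))) + - 1).
  rewrite CexpectationD//; congr (_ + _).
  rewrite CexpectationE !Rintegral_cst// [X in fine X]probability_setT.
  by apply/eqP; rewrite eq_complex /= !mulr1 !eqxx.
have i2 : P.-integrable setT (fun w => (2 * \1_B (X i w))%:E).
  by under eq_fun do rewrite EFinM; exact: integrableZl.
have ie := finite_measure_integrable_cst P e measurableT.
apply: (@le_trans _ _ (\int[P]_w (e + 2 * \1_B (X i w)))).
  apply: le_normc_Cexpectation.
  - exact: CintegrableD.
  - by under eq_fun do rewrite EFinD; exact: integrableD.
  move=> w; rewrite indicE; have [Bx|nBx] := boolP (X i w \in B).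
    by rewrite (le_trans (normc_expi_sub1_le2 _))// mulr1 lerDr.
  apply: (le_trans (normc_expi_sub1 _)); rewrite mulr0 addr0 normrN normrM.
  rewrite (ger0_norm s0); apply: le_trans (gB (x := X i w) _).
    by rewrite ler_piMl.
  by move: nBx; rewrite notin_setE.
have Ee : \int[P]_w e = e.
  by rewrite Rintegral_cst// [X in fine X]probability_setT mulr1.
rewrite RintegralD// Ee RintegralZl//; last exact: iB.
rewrite lerD2l ler_pM2l//.
apply: le_trans (PB i).
rewrite /Rintegral -[X in fine X]/(\int[P]_w (\1_(X i @^-1` B) w)%:E)%E.
rewrite integral_indic ?setIT//.
by rewrite -[_ @^-1` _]setTI; exact: mX.
Qed.

(** As E[Y] = 0, subtracting Y changes nothing, and the quantity is E[Y (exp(-isY) - 1 + isY)]. The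
    integrand is at most 2 s Y^2 on [B], and at most 2 s^2 |Y|^3 <= 2 s e Y^2 off [B]. *)
Lemma normc_remainder s i : 0 <= s <= 1 ->
  Normc.normc (zeta s i + (0 +i* (s * \int[P]_w g (X i w) ^+ 2))%C) <=
  2 * s * (\int[P]_w (g (X i w) ^+ 2 * \1_B (X i w))) +
  2 * s * e * \int[P]_w g (X i w) ^+ 2.
Proof.
move=> /andP[s0 s1].
have cY : Cintegrable P (fun w => - 1 * (g (X i w))%:C%C).
  by apply: CintegrableZ; exact: Cintegrable_real.
have cY2 : Cintegrable P (fun w => (0 +i* s)%C * (g (X i w) ^+ 2)%:C%C).
  by apply: CintegrableZ; exact: Cintegrable_real.
have -> : zeta s i + (0 +i* (s * \int[P]_w g (X i w) ^+ 2))%C =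
  Cexpectation P (fun w => (g (X i w))%:C%C * expi (- (s * g (X i w))) +
    - 1 * (g (X i w))%:C%C + (0 +i* s)%C * (g (X i w) ^+ 2)%:C%C).
  rewrite CexpectationD//; last exact: CintegrableD.
  rewrite CexpectationD// CexpectationZ; last exact: Cintegrable_real.
  rewrite CexpectationZ; last exact: Cintegrable_real.
  rewrite !Cexpectation_real meanY mulr0 addr0; congr (_ + _).
  by apply/eqP; rewrite eq_complex /=; apply/andP; split; apply/eqP; ring.
have i1 : P.-integrable setT (fun w => (2 * s * (g (X i w) ^+ 2 * \1_B (X i w)))%:E).
  by under eq_fun do rewrite EFinM; exact: integrableZl.
have i2 : P.-integrable setT (fun w => (2 * s * e * g (X i w) ^+ 2)%:E).
  by under eq_fun do rewrite EFinM; exact: integrableZl.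
rewrite -(RintegralZl _ measurableT (iYB i)) -(RintegralZl _ measurableT (sqY i)) -RintegralD//.
apply: le_normc_Cexpectation.
- by apply: CintegrableD => //; apply: CintegrableD => //; exact: cZ.
- by under eq_fun do rewrite EFinD; exact: integrableD.
move=> w; set x := X i w.
have -> : (g x)%:C%C * expi (- (s * g x)) + - 1 * (g x)%:C%C + (0 +i* s)%C * (g x ^+ 2)%:C%C
   = (g x)%:C%C * (expi (- (s * g x)) - 1 + (0 +i* (s * g x))%C).
  by apply/eqP; rewrite eq_complex /=; apply/andP; split; apply/eqP; ring.
rewrite Normc.normcM.
have -> : Normc.normc (g x)%:C%C = `|g x|.
  by rewrite /= expr0n addr0 sqrtr_sqr.
rewrite indicE; have [Bx|nBx] := boolP (x \in B).
  apply: (le_trans (ler_wpM2l (normr_ge0 _) (normc_expi_sub2_le2 _))).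
  rewrite normrM (ger0_norm s0) -(real_normK (num_real (g x))) mulr1.
  have : 0 <= s * e * `|g x| ^+ 2 by rewrite !mulr_ge0.
  by lra.
apply: (le_trans (ler_wpM2l (normr_ge0 _) (normc_expi_sub2 _))).
have := gB (x := x); rewrite notin_setE in nBx => /(_ nBx) gxe.
rewrite !mulr0 add0r exprMn -(real_normK (num_real (g x))).
have g2 : 0 <= `|g x| ^+ 2 by rewrite sqr_ge0.
have : s ^+ 2 * `|g x| ^+ 2 * `|g x| <= s * `|g x| ^+ 2 * e.
  apply: ler_pM => //; first by rewrite mulr_ge0// sqr_ge0.
  by rewrite ler_wpM2r// expr2 ler_piMr.
by lra.
Qed.

Lemma dist_charfun_row_gauss :
  Normc.normc (Cexpectation P (fun w => expi (- S w)) -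
               (expR (- (tau / 2)))%:C%C) <= 2 * l + 3 * e + 2 * M.
Proof.
have mS : measurable_fun setT S by exact: measurable_sum.
have iS : P.-integrable setT (fun w => (S w)%:E).
  under eq_fun do rewrite -sumEFin.
  by apply: (integrable_sum measurableT) => i _; exact: iY.
have v0 i : 0 <= \int[P]_w g (X i w) ^+ 2.
  by apply: Rintegral_ge0 => w _; exact: sqr_ge0.
have tau0 : 0 <= tau by apply: sumr_ge0.
apply: dist_charfun_gauss => //; first by rewrite !addr_ge0 ?mulr_ge0.
move=> s s01; have /andP[s0 s1] := s01.
rewrite mul_charfun_row charfun_row.
pose v i := \int[P]_w g (X i w) ^+ 2.
pose psi k := \prod_(i | i != k) phi s i.
(* Each full product is phi_k psi_k, and phi_k = 1 + (phi_k - 1): zeta_k + i s v_k is the Taylor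
   remainder, and i s v_k (phi_k - 1) is the price of the missing factor. *)
have -> : \sum_k zeta s k * \prod_(i | i != k) phi s i + (0 +i* (s * tau))%C * \prod_i phi s i
   = \sum_k (zeta s k + (0 +i* (s * v k))%C + (0 +i* (s * v k))%C * (phi s k - 1)) * psi k.
  have -> : (0 +i* (s * tau))%C = \sum_k (0 +i* (s * v k))%C :> R[i].
    have E (x : R) : (0 +i* x)%C = 'i%C * x%:C%C :> R[i].
      by apply/eqP; rewrite eq_complex /=; apply/andP; split; apply/eqP; ring.
    by under eq_bigr do rewrite E; rewrite -mulr_sumr E -rmorph_sum mulr_sumr.
  rewrite mulr_suml -big_split /=; apply: eq_bigr => k _.
  by rewrite [X in _ + _ * X](bigD1 k)//= -/(psi k); ring.
have psi1 k : Normc.normc (psi k) <= 1.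
  rewrite (big_morph _ (@Normc.normcM R) (@Normc.normc1 R)).
  by apply: prodr_ile1 => i _; rewrite normc_ge0 normc_charfun_le1.
(* Summed over k, the remainders give at most s tau (2 l + 2 e) and the missing factors s tau (e + 2
   M). *)
apply: (le_trans (ler_normc_sum (G := fun k =>
   2 * s * (\int[P]_w (g (X k w) ^+ 2 * \1_B (X k w))) + 2 * s * e * v k
   + s * v k * (e + 2 * M)) _ _)).
  move=> k; rewrite Normc.normcM.
  apply: (le_trans (ler_piMr (normc_ge0 _) (psi1 k))).
  apply: (le_trans (le_normcD _ _)); apply: lerD; first exact: normc_remainder.
  rewrite Normc.normcM; apply: ler_pM => //; rewrite ?normc_ge0 ?normc_charfun_sub1//.
  by rewrite /= expr0n add0r sqrtr_sqr ger0_norm//; exact: mulr_ge0 s0 (v0 k).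
rewrite !big_split /= -!mulr_sumr -mulr_suml -mulr_sumr -/tau.
have := ler_wpM2l s0 tailY; nra.
Qed.

End independent_row.

(** * Euclidean vectors and the multivariate normal law *)

Section euclidean.
Context {R : realType} {N : nat}.
Implicit Types x t : 'rV[R]_N.

Lemma dotp_ge0 x : 0 <= dotp x x.
Proof. by apply: sumr_ge0 => i _; rewrite -expr2 sqr_ge0. Qed.

Lemma sqr_enorm x : enorm x ^+ 2 = dotp x x.
Proof. by rewrite sqr_sqrtr// dotp_ge0. Qed.

Lemma enorm_ge0 x : 0 <= enorm x.
Proof. exact: sqrtr_ge0. Qed.

Lemma sqr_coord_le x i : x 0 i ^+ 2 <= enorm x ^+ 2.
Proof.
rewrite sqr_enorm /dotp (bigD1 i)//= expr2 lerDl.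
by apply: sumr_ge0 => j _; rewrite -expr2 sqr_ge0.
Qed.

Lemma dotp_sumr (I : Type) (s : seq I) t (f : I -> 'rV[R]_N) :
  dotp t (\sum_(k <- s) f k) = \sum_(k <- s) dotp t (f k).
Proof.
rewrite /dotp exchange_big/=; apply: eq_bigr => i _.
by rewrite summxE mulr_sumr.
Qed.

(* Lagrange: the sum of the squares [(t_i x_j - t_j x_i)^2] is nonnegative. *)
Lemma sqr_dotp_le t x : dotp t x ^+ 2 <= enorm t ^+ 2 * enorm x ^+ 2.
Proof.
rewrite !sqr_enorm -subr_ge0.
suff -> : dotp t t * dotp x x - dotp t x ^+ 2 =
    2^-1 * \sum_i \sum_j (t 0 i * x 0 j - t 0 j * x 0 i) ^+ 2.
  rewrite mulr_ge0 ?invr_ge0//.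
  by apply: sumr_ge0 => i _; apply: sumr_ge0 => j _; exact: sqr_ge0.
have E : \sum_i \sum_j (t 0 i * x 0 j - t 0 j * x 0 i) ^+ 2 =
    dotp t t * dotp x x + dotp t t * dotp x x - 2 * dotp t x ^+ 2.
  have E1 (a b : 'I_N -> R) : (\sum_i a i) * (\sum_j b j) = \sum_i \sum_j a i * b j.
    by rewrite mulr_suml; apply: eq_bigr => i _; rewrite mulr_sumr.
  rewrite {2}[dotp t t * _]mulrC expr2 /dotp !E1 mulr_sumr -sumrN -!big_split /=.
  apply: eq_bigr => i _; rewrite mulr_sumr -sumrN -!big_split /=.
  by apply: eq_bigr => j _; ring.
by rewrite E; field.
Qed.

Lemma measurable_coord (i : 'I_N) :
  measurable_fun setT (fun x : borelRV R N => (x : 'rV[R]_N) 0 i : R).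
Proof.
apply: (measurability _ (RGenOpens.measurableE R)).
move=> /= _ [_ [a [b ->]] <-]; rewrite setTI.
apply: sub_sigma_algebra.
have /continuousP := @coord_continuous R 1 N 0 i; apply.
exact: interval_open.
Qed.

Lemma measurable_dotp t :
  measurable_fun setT (fun x : borelRV R N => dotp t x).
Proof.
apply: measurable_sum => i; apply: measurable_funM => //.
exact: measurable_coord.
Qed.

Lemma measurable_enorm : measurable_fun setT (fun x : borelRV R N => enorm x).
Proof.
apply: (measurableT_comp (f := @Num.sqrt R)).
  by apply: continuous_measurable_fun; exact: sqrt_continuous.
by apply: measurable_sum => i; apply: measurable_funM; exact: measurable_coord.
Qed.

End euclidean.

Section charfun_std_normal.
Context d (T : measurableType d) (R : realType) (P : probability T R) (N : nat).

Lemma charfun_std_normal (H : {RV P >-> borelRV R N}) (t : 'rV[R]_N) :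
  std_normal P H -> charfun P H t = (expR (- (enorm t ^+ 2 / 2)))%:C%C.
Proof.
move=> [indH nH].
have mH i : measurable_fun setT (vcoord i H : T -> measurableTypeR R).
  exact: (measurableT_comp (measurable_coord i)).
have mtr (h : R -> R) i : continuous h -> measurable_fun setT (fun x : measurableTypeR R => h (- (t 0 i * x))).
  move=> ch; apply: (measurableT_comp (f := h)); first exact: continuous_measurable_fun.
  by apply: measurableT_comp => //; exact: measurable_funM.
have := @Cintegrable_prod _ _ _ _ _ P _ _ mH indH
  (fun i (x : measurableTypeR R) => expi (- (t 0 i * x))).
case.
- by move=> i; apply: mtr; exact: continuous_cos.
- by move=> i; apply: mtr; exact: continuous_sin.
- move=> i; split.
  + apply: (@integrable_bounded _ _ _ P _ 1) => [|w]; last exact: cos_max.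
    exact: (measurableT_comp (mtr _ i (@continuous_cos R)) (mH i)).
  + apply: (@integrable_bounded _ _ _ P _ 1) => [|w]; last exact: sin_max.
    exact: (measurableT_comp (mtr _ i (@continuous_sin R)) (mH i)).
move=> _ E; rewrite /charfun.
have -> : (fun w => expi (- dotp t (H w))) =
    (fun w => \prod_i expi (- (t 0 i * vcoord i H w))).
  by apply/funext => w; rewrite /dotp -sumrN expi_sum.
rewrite E; under eq_bigr => i _ do rewrite (charfun_standard_normal (mH i) (nH i)).
rewrite -rmorph_prod -expR_sum; congr (expR _)%:C%C.
by rewrite sumrN -mulr_suml sqr_enorm; congr (- (_ / _)); apply: eq_bigr => i _; rewrite expr2.
Qed.

End charfun_std_normal.

(** * One row of the array, with an explicit error *)

Section standard_row.
Context d (T : measurableType d) (R : realType) (P : probability T R) (N n : nat).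
Variable Xi : 'I_n -> {RV P >-> borelRV R N}.
Let S w : 'rV[R]_N := \sum_(k < n) (Xi k w : 'rV[R]_N).
Hypothesis indXi : mutually_independent P (fun k : 'I_n => Xi k : T -> borelRV R N).
Hypothesis meanXi : forall (k : 'I_n) (i : 'I_N),
  ('E_P[vcoord i (Xi k : T -> 'rV[R]_N)] = 0)%E.
Hypothesis covS : forall i j : 'I_N,
  covariance P (vcoord i S) (vcoord j S) = ((1%:M : 'M[R]_N) i j)%:E.
Variables (eps l M : R).
Hypotheses (eps0 : 0 < eps) (l0 : 0 <= l) (M0 : 0 <= M).
Hypothesis tailXi : (\sum_(k < n)
  'E_P[(fun w => enorm (Xi k w) ^+ 2 *
                 \1_[set w' | eps < enorm (Xi k w')] w)%R] <= l%:E)%E.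
Hypothesis PXi : forall k : 'I_n, (P [set w | (eps < enorm (Xi k w))%R] <= M%:E)%E.

Let B : set (borelRV R N) := [set x | eps < enorm (x : 'rV[R]_N)].

Let mB : measurable B.
Proof.
have := @measurable_enorm R N measurableT _ (measurable_itv `]eps, +oo[).
rewrite setTI; congr measurable; apply/seteqP.
by split => x /=; rewrite in_itv/= andbT.
Qed.

Let mXi k : measurable_fun setT (Xi k : T -> borelRV R N).
Proof. exact: measurable_funP. Qed.

Let men k : measurable_fun setT (fun w => enorm (Xi k w : 'rV[R]_N)).
Proof. exact: (measurableT_comp measurable_enorm (mXi k)). Qed.

Let mB1 k : measurable_fun setT (fun w => \1_B (Xi k w) : R).
Proof. exact: (measurableT_comp (measurable_indic mB) (mXi k)). Qed.

Let tail0 k w : 0 <= enorm (Xi k w : 'rV[R]_N) ^+ 2 * \1_B (Xi k w).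
Proof. by rewrite mulr_ge0 ?sqr_ge0. Qed.

Let tail_expectation k :
  ('E_P[(fun w => enorm (Xi k w) ^+ 2 *
                 \1_[set w' | eps < enorm (Xi k w')] w)%R] =
   \int[P]_w (enorm (Xi k w : 'rV[R]_N) ^+ 2 * \1_B (Xi k w))%:E)%E.
Proof. by rewrite unlock. Qed.

Let integrable_tail k :
  P.-integrable setT (fun w => (enorm (Xi k w : 'rV[R]_N) ^+ 2 * \1_B (Xi k w))%:E).
Proof.
apply/integrableP; split.
  by apply/measurable_EFinP/measurable_funM => //; exact: measurable_funX.
under eq_integral do rewrite gee0_abs ?lee_fin//.
apply: le_lt_trans (ltry l); apply: le_trans tailXi.
rewrite (bigD1 k)//= tail_expectation leeDl// sume_ge0// => j _.
by rewrite tail_expectation integral_ge0// => w _; rewrite lee_fin.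
Qed.

Let tail_le : \sum_k \int[P]_w (enorm (Xi k w : 'rV[R]_N) ^+ 2 * \1_B (Xi k w)) <= l.
Proof.
rewrite -lee_fin -sumEFin; apply: le_trans tailXi.
apply: lee_sum => k _; rewrite tail_expectation /Rintegral fineK//.
exact: integrable_fin_num (integrable_tail k).
Qed.

(** The covariance condition speaks of row sums only. For the entries, |x|^2 <= eps^2 + |x|^2 1_B,
    and the last term is integrable because the Lindeberg sum is at most the real number [l]. *)
Let integrable_enorm2 k :
  P.-integrable setT (fun w => (enorm (Xi k w : 'rV[R]_N) ^+ 2)%:E).
Proof.
apply: (@integrable_dominated _ _ _ P _
  (fun w => eps ^+ 2 + enorm (Xi k w : 'rV[R]_N) ^+ 2 * \1_B (Xi k w))).
- exact: measurable_funX.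
- under eq_fun do rewrite EFinD; apply: integrableD => //.
  exact: (finite_measure_integrable_cst P _ measurableT).
move=> w; rewrite !ger0_norm ?sqr_ge0 ?addr_ge0 ?sqr_ge0//.
rewrite indicE; have [_|] := boolP (_ \in B); first by rewrite mulr1 lerDr sqr_ge0.
rewrite notin_setE /B /= => /negP; rewrite -leNgt => H.
by rewrite mulr0 addr0 ler_sqr ?nnegrE ?enorm_ge0// ltW.
Qed.

Let integrable_coord2 k i : P.-integrable setT (fun w => ((Xi k w : 'rV[R]_N) 0 i ^+ 2)%:E).
Proof.
apply: integrable_dominated (integrable_enorm2 k) _.
  by apply: measurable_funX; exact: (measurableT_comp (measurable_coord i) (mXi k)).
by move=> w; rewrite !ger0_norm ?sqr_ge0// sqr_coord_le.
Qed.

Let integrable_coord k i : P.-integrable setT (fun w => ((Xi k w : 'rV[R]_N) 0 i)%:E).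
Proof.
exact: (integrable_square mXi (measurable_coord i) (integrable_coord2^~ i)).
Qed.

Let mean_coord k i : \int[P]_w ((Xi k w : 'rV[R]_N) 0 i) = 0.
Proof. by have := meanXi k i; rewrite unlock /Rintegral => ->. Qed.

Let SE i w : vcoord i S w = \sum_(k < n) (Xi k w : 'rV[R]_N) 0 i.
Proof. by rewrite /vcoord /S summxE. Qed.

Let mS i : measurable_fun setT (vcoord i S).
Proof.
rewrite (funext (SE i)).
by apply: measurable_sum => k; exact: (measurableT_comp (measurable_coord i) (mXi k)).
Qed.

Let expectation_S i j :
  (\int[P]_w (vcoord i S w * vcoord j S w)%:E = ((1%:M : 'M[R]_N) i j)%:E)%E.
Proof.
(* Row sums are centred, so their covariances are plain second moments. *)
have m0 q : fine 'E_P[vcoord q S] = 0.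
  rewrite unlock -[LHS]/(\int[P]_w vcoord q S w).
  under eq_Rintegral do rewrite SE.
  by rewrite Rintegral_sum// big1.
rewrite -covS covariance.unlock !m0 expectation.unlock.
by apply: eq_integral => w _; rewrite fctE /= !subr0.
Qed.

Let integrable_SS i j :
  P.-integrable setT (fun w => (vcoord i S w * vcoord j S w)%:E).
Proof.
have sq q : P.-integrable setT (fun w => (vcoord q S w * vcoord q S w)%:E).
  apply/integrableP; split; first by apply/measurable_EFinP/measurable_funM.
  under eq_integral do rewrite gee0_abs ?lee_fin -?expr2 ?sqr_ge0// expr2.
  by rewrite expectation_S ltry.
apply: (@integrable_dominated _ _ _ P _
  (fun w => vcoord i S w * vcoord i S w + vcoord j S w * vcoord j S w)).
- exact: measurable_funM.
- by under eq_fun do rewrite EFinD; exact: integrableD.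
move=> w; rewrite -!expr2 [leRHS]ger0_norm ?addr_ge0 ?sqr_ge0// normrM.
rewrite -(real_normK (num_real (vcoord i S w))) -(real_normK (num_real (vcoord j S w))).
have := sqr_ge0 (`|vcoord i S w| - `|vcoord j S w|).
by have := normr_ge0 (vcoord i S w); have := normr_ge0 (vcoord j S w); nra.
Qed.

(** The scalar estimate for g = <t, .> and e = |t| eps. Expanding <t, S>^2 in coordinates, the
    identity covariance leaves tau = |t|^2, the very factor that Cauchy-Schwarz puts in front of the
    tails. *)
Lemma dist_charfun_standard_row (t : 'rV[R]_N) :
  Normc.normc ((expR (- (enorm t ^+ 2 / 2)))%:C%C - charfun P S t) <=
  2 * l + 3 * (enorm t * eps) + 2 * M.
Proof.
have sqY k : P.-integrable setT (fun w => (dotp t (Xi k w : 'rV[R]_N) ^+ 2)%:E).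
  apply: (@integrable_dominated _ _ _ P _ (fun w => enorm t ^+ 2 * enorm (Xi k w : 'rV[R]_N) ^+ 2)).
  - by apply: measurable_funX; exact: (measurableT_comp (measurable_dotp t) (mXi k)).
  - by under eq_fun do rewrite EFinM; exact: integrableZl.
  by move=> w; rewrite !ger0_norm ?sqr_dotp_le ?sqr_ge0 ?mulr_ge0 ?sqr_ge0 ?enorm_ge0.
have meanY k : \int[P]_w dotp t (Xi k w : 'rV[R]_N) = 0.
  rewrite /dotp Rintegral_sum; last first.
    by move=> i; under eq_fun do rewrite EFinM; exact: integrableZl.
  by apply: big1 => i _; rewrite RintegralZl// ?mean_coord ?mulr0//; exact: integrable_coord.
have tauE : \sum_k \int[P]_w dotp t (Xi k w : 'rV[R]_N) ^+ 2 = enorm t ^+ 2.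
  rewrite (orthogonal_row mXi indXi (measurable_dotp t))//.
  have E w : (\sum_k dotp t (Xi k w : 'rV[R]_N)) ^+ 2 =
      \sum_i \sum_j t 0 i * t 0 j * (vcoord i S w * vcoord j S w).
    rewrite -dotp_sumr expr2 /dotp mulr_suml; apply: eq_bigr => i _.
    by rewrite mulr_sumr; apply: eq_bigr => j _; rewrite /vcoord /S; ring.
  under eq_Rintegral do rewrite E.
  have iZ i j : P.-integrable setT (fun w => (t 0 i * t 0 j * (vcoord i S w * vcoord j S w))%:E).
    by under eq_fun do rewrite EFinM; exact: integrableZl.
  rewrite Rintegral_sum; last first.
    move=> i; under eq_fun do rewrite -sumEFin.
    by apply: integrable_sum => // j _; exact: iZ.
  rewrite sqr_enorm; apply: eq_bigr => i _.
  have Eij j : \int[P]_w (t 0 i * t 0 j * (vcoord i S w * vcoord j S w)) =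
      t 0 i * t 0 j * (1%:M : 'M[R]_N) i j.
    by rewrite (RintegralZl _ measurableT (integrable_SS i j)) {1}/Rintegral expectation_S.
  rewrite Rintegral_sum// (bigD1 i)//= [X in _ + X]big1 ?addr0 ?Eij.
    by rewrite mxE eqxx mulr1.
  by move=> j ji; rewrite Eij mxE eq_sym (negPf ji) mulr0.
have gB (x : borelRV R N) : ~ B x -> `|dotp t (x : 'rV[R]_N)| <= enorm t * eps.
  rewrite /B /= => /negP; rewrite -leNgt => xe.
  rewrite -ler_sqr ?nnegrE ?mulr_ge0 ?enorm_ge0 ?(ltW eps0)// real_normK ?num_real//.
  apply: le_trans (sqr_dotp_le _ _) _; rewrite exprMn ler_wpM2l ?sqr_ge0//.
  by rewrite ler_sqr ?nnegrE ?enorm_ge0// ltW.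
have tailY : \sum_k \int[P]_w (dotp t (Xi k w : 'rV[R]_N) ^+ 2 * \1_B (Xi k w)) <=
    (\sum_k \int[P]_w dotp t (Xi k w : 'rV[R]_N) ^+ 2) * l.
  rewrite tauE; apply: le_trans (ler_wpM2l (sqr_ge0 (enorm t)) tail_le).
  rewrite mulr_sumr; apply: ler_sum => k _.
  rewrite -(RintegralZl _ measurableT (integrable_tail k)).
  have iZ : P.-integrable setT (fun w =>
     (enorm t ^+ 2 * (enorm (Xi k w : 'rV[R]_N) ^+ 2 * \1_B (Xi k w)))%:E).
    by under eq_fun do rewrite EFinM; exact: integrableZl.
  have le w : dotp t (Xi k w : 'rV[R]_N) ^+ 2 * \1_B (Xi k w) <=
      enorm t ^+ 2 * (enorm (Xi k w : 'rV[R]_N) ^+ 2 * \1_B (Xi k w)).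
    by rewrite mulrA ler_wpM2r// sqr_dotp_le.
  apply: le_Rintegral => //; apply: integrable_dominated iZ _.
    apply: measurable_funM => //.
    by apply: measurable_funX; exact: (measurableT_comp (measurable_dotp t) (mXi k)).
  move=> w; rewrite ger0_norm; last by rewrite mulr_ge0 ?sqr_ge0.
  by rewrite ger0_norm ?le// mulr_ge0 ?sqr_ge0 ?tail0.
have PB k : fine (P (Xi k @^-1` B)) <= M.
  have := PXi k; rewrite -[X in (P X <= _)%E]/(Xi k @^-1` B) => PM.
  rewrite -lee_fin fineK// fin_num_measure//.
  by rewrite -[_ @^-1` _]setTI; exact: mXi.
have := dist_charfun_row_gauss mXi indXi (measurable_dotp t) mB sqY meanY gB tailY PB _ l0 M0.
rewrite tauE => /(_ (mulr_ge0 (enorm_ge0 t) (ltW eps0))).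
rewrite -normcN opprB /charfun.
have -> // : (fun w => expi (- dotp t (S w))) =
  (fun w => expi (- \sum_(i < n) dotp t (Xi i w : 'rV[R]_N))).
by apply/funext => w; rewrite /S dotp_sumr.
Qed.

End standard_row.

(** * Passage to the limit *)

Section limn_esup.
Context {R : realType}.
Local Open Scope ereal_scope.

(** The upper limit is an infimum of suprema over neighbourhoods of infinity, so some neighbourhood
    already has its supremum below c. *)
Lemma limn_esup_lt_near (u : (\bar R)^nat) (c : \bar R) :
  limn_esup u < c -> \forall n \near \oo, u n < c.
Proof.
move=> /ereal_inf_lt[_ [V [m _ mV] <-] uc].
exists m => // n mn; apply: le_lt_trans uc.
by apply: ereal_sup_ubound; exists n => //; exact: mV.
Qed.

Lemma limn_esup_near_le (u : (\bar R)^nat) (c : \bar R) :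
  (\forall n \near \oo, u n <= c) -> limn_esup u <= c.
Proof.
move=> uc; apply: (@le_trans _ _ (ereal_sup (u @` [set n | u n <= c]))).
  by apply: ereal_inf_lbound; exists [set n | u n <= c].
by apply: ge_ereal_sup => _ [n /= un <-].
Qed.

End limn_esup.

Theorem corollary2p6 (R : realType) (N : nat) (hN : (1 <= N)%N)
  (d0 : measure_display) (T0 : measurableType d0) (P0 : probability T0 R)
  (H : {RV P0 >-> borelRV R N}) (hH : std_normal P0 H)
  (d : nat -> measure_display) (T : forall n, measurableType (d n))
  (P : forall n, probability (T n) R)
  (Xi : forall n, 'I_n -> {RV (P n) >-> borelRV R N})
  (hXi : STA Xi) (hinf : infinitesimal Xi) :
  (limit_op P (row_sum Xi) P0 H <= 2%:E * Lin Xi)%E.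
Proof.
pose L (e : R) n := (\sum_(k < n)
  'E_(P n)[(fun w => enorm (Xi n k w) ^+ 2 *
                     \1_[set w' | e < enorm (Xi n k w')] w)%R])%E.
have LinE (e : R) : 0 < e -> (limn_esup (L e) <= Lin Xi)%E.
  by move=> e0; apply: ereal_sup_ubound; exists e.
have Lin0 : (0 <= Lin Xi)%E.
  apply: le_trans (LinE 1 ltr01); apply: limf_esup_ge0 => [|n].
    by case=> m _ /(_ m (leqnn m)).
  apply: sume_ge0 => k _; apply: expectation_ge0 => w.
  by rewrite mulr_ge0 ?sqr_ge0.
apply: ge_ereal_sup => _ [t _ <-].
have [->|Linoo] := eqVneq (Lin Xi) +oo%E.
  by rewrite mulry gtr0_sg// mul1e leey.
have Lf : Lin Xi \is a fin_num by rewrite ge0_fin_numE// ltey.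
set r := fine (Lin Xi).
have rE : Lin Xi = r%:E by rewrite fineK.
have r0 : 0 <= r by rewrite fine_ge0.
rewrite rE -EFinM; apply/lee_addgt0Pr => e e0; rewrite -EFinD.
(* A single [eta] serves as truncation level, as slack above Lin and as bound on the probabilities.
   The row estimate then reads 2 (r + eta) + 3 |t| eta + 2 eta = 2 r + c eta, and [eta] is chosen so
   that c eta = e. *)
pose c := 4 + 3 * enorm t.
have c0 : 0 < c by rewrite /c ltr_wpDr// mulr_ge0// enorm_ge0.
pose eta := e / c.
have eta0 : 0 < eta by rewrite divr_gt0.
have cE : c * eta = e by rewrite /eta mulrCA divff ?mulr1// gt_eqF.
apply: limn_esup_near_le.
have nL : \forall n \near \oo, (L eta n < (r + eta)%:E)%E.
  apply: limn_esup_lt_near; apply: le_lt_trans (LinE _ eta0) _.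
  by rewrite rE lte_fin ltrDl.
have nM : \forall n \near \oo,
    (\big[maxe/0%E]_(k < n) P n [set w | eta < enorm (Xi n k w)]%R < eta%:E)%E.
  have /(_ [set x | (x < eta%:E)%E]) := hinf _ eta0; apply.
  exact: (open_ereal_lt' (x := 0%E) (y := eta%:E)).
near=> n; rewrite lee_fin.
(* Independence and covariance are prescribed from row 1 on; row 0 is discarded. *)
have n0 : (0 < n)%N by near: n; exact: nbhs_infty_gt.
rewrite (charfun_std_normal t hH).
have := @dist_charfun_standard_row _ _ _ (P n) N n (Xi n)
  (STA_indep hXi n0) (STA_mean hXi (n := n)) (STA_cov hXi n0) eta (r + eta) eta eta0.
move=> /(_ _ (ltW eta0) _ _ t) H1; apply: le_trans (H1 _ _ _) _.
- by rewrite addr_ge0// ltW.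
- by apply: ltW; near: n.
- move=> k; apply: (@le_trans _ _ (\big[maxe/0%E]_(k < n)
      P n [set w | eta < enorm (Xi n k w)])).
    exact: le_bigmax.
  by apply: ltW; near: n; exact: nM.
by rewrite -cE /c; lra.
Unshelve. all: by end_near. Qed.
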